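(* Let $q$ be a real number with $0<|q|<1$ and let $(\Omega,d)$ be Woronowicz's three-dimensional $*$-differential calculus over the Hopf $*$-algebra $\mathcal{A}_q$ of $SU_q(2)$, with the left-invariant inner product on $\Omega$ for which $1,\ \eta_1,\eta_2,\eta_3,\ q^{-7}\eta_1\eta_2,\ q\,\eta_2\eta_3,\ -q^{-6}\eta_3\eta_1,\ \eta_1\eta_2\eta_3$ is an orthonormal basis of $\Omega^{\mathrm{inv}}$. Let $D=d+d^*$, $\nabla=D^2$, $R=(1+\nabla)^{-1/2}$ and, for $a\in\mathcal{A}_q$, let $L_a$ be the operator $\omega\mapsto a\omega$ on $\Omega$. Let $\beta$ and $\delta$ be nonnegative numbers for which $\beta+\delta=1$. Then $R^\beta[L_a,D]R^\delta$ is a bounded operator on $\Omega$, for all $a\in\mathcal{A}_q$.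
   Context: $\mathcal{A}_q$ is the universal unital $*$-algebra generated by $\alpha,\gamma$ with $\alpha^*\alpha+\gamma^*\gamma=1$, $\alpha\alpha^*+q^2\gamma\gamma^*=1$, $\gamma\gamma^*=\gamma^*\gamma$, $\alpha\gamma=q\gamma\alpha$, $\alpha\gamma^*=q\gamma^*\alpha$, with $\Delta(\alpha)=\alpha\otimes\alpha-q\gamma^*\otimes\gamma$, $\Delta(\gamma)=\gamma\otimes\alpha+\alpha^*\otimes\gamma$; $h$ is its (positive, faithful) Haar integral. The calculus: $\Omega=\bigoplus_{k=0}^3\Omega_k$ is a graded algebra with $\Omega_0=\mathcal{A}_q$, generated by $\mathcal{A}_q$ and $1$-forms $\eta_1,\eta_2,\eta_3$; as left $\mathcal{A}_q$-modules, $\Omega_1,\Omega_2,\Omega_3$ are free with bases $\{\eta_1,\eta_2,\eta_3\}$, $\{\eta_1\eta_2,\eta_2\eta_3,\eta_3\eta_1\}$, $\{\eta_1\eta_2\eta_3\}$. Relations: $\eta_r^2=0$, $\eta_2\eta_1=-q^4\eta_1\eta_2$, $\eta_3\eta_2=-q^4\eta_2\eta_3$, $\eta_1\eta_3=-q^{-2}\eta_3\eta_1$; $\eta_r\alpha=q^{-\varepsilon_r}\alpha\eta_r$, $\eta_r\gamma=q^{-\varepsilon_r}\gamma\eta_r$, $\eta_r\alpha^*=q^{\varepsilon_r}\alpha^*\eta_r$, $\eta_r\gamma^*=q^{\varepsilon_r}\gamma^*\eta_r$ with $\varepsilon_1=\varepsilon_3=1$, $\varepsilon_2=2$. The graded involution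 satisfies $(\omega_1\omega_2)^*=(-1)^{kl}\omega_2^*\omega_1^*$ for $\omega_1\in\Omega_k$, $\omega_2\in\Omega_l$, and $\eta_1^*=q\eta_3$, $\eta_2^*=-\eta_2$, $\eta_3^*=q^{-1}\eta_1$. The differential $d$ is the degree-one graded derivation ($d(\omega'\omega)=d(\omega')\omega+(-1)^k\omega'd\omega$ for $\omega'\in\Omega_k$) with $d^2=0$, $d(\omega^* )=(d\omega)^*$ and $$d\alpha=\alpha\eta_2-q^2\gamma^*\eta_3,\quad d\gamma=\gamma\eta_2+q\alpha^*\eta_3,\quad d\alpha^*=-q^2\alpha^*\eta_2-\gamma\eta_1,\quad d\gamma^*=-q^2\gamma^*\eta_2+q^{-1}\alpha\eta_1,$$ $$d\eta_1=q^2(1+q^2)\eta_1\eta_2,\quad d\eta_2=q\eta_1\eta_3,\quad d\eta_3=q^2(1+q^2)\eta_2\eta_3.$$ The space $\Omega^{\mathrm{inv}}$ of left-invariant forms is the span of $1,\eta_1,\eta_2,\eta_3,\eta_1\eta_2,\eta_2\eta_3,\eta_3\eta_1,\eta_1\eta_2\eta_3$, and $\Omega\cong\mathcal{A}_q\otimes\Omega^{\mathrm{inv}}$ via $a\otimes\omega\mapsto a\omega$. An inner product on $\Omega$ (linear in the first variable) is left-invariant if $(a\omega\mid b\eta)=h(b^*a)(\omega\mid\eta)$ for $a,b\in\mathcal{A}_q$, $\omega,\eta\in\Omega^{\mathrm{inv}}$. The operator $d$ has an adjoint $d^*$ on $\Omega$ for this inner product. The space $\Omega$ is the orthogonal direct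 sum of finite-dimensional subspaces invariant under the self-adjoint operator $\nabla\ge0$, so $\Omega$ has an orthonormal linear basis of eigenvectors of $\nabla$; for $s\ge0$, $R^s$ is the operator multiplying an eigenvector with eigenvalue $t$ by $(1+t)^{-s/2}$. ''Bounded'' is with respect to the norm on the (incomplete) inner product space $\Omega$. $[L_a,D]=L_aD-DL_a$. *)

(* Defs.v *)
From HB Require Import structures.
From mathcomp Require Import all_boot all_order all_algebra.
From mathcomp Require Export sesquilinear complex.
From mathcomp Require Import reals exp.

Set Implicit Arguments.
Unset Strict Implicit.
Unset Printing Implicit Defensive.

Import Order.TTheory GRing.Theory Num.Theory.

Local Open Scope ring_scope.
Local Open Scope complex_scope.

(* The algebra A_q, its tensor square, the calculus Omega and all the maps   *)
(* between them are determined up to isomorphism by universal properties or  *)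
(* by presentations. Each is described by a predicate on an arbitrary        *)
(* realization, so that a theorem quantified over realizations applies to    *)
(* any construction. Below, q is the complex scalar attached to the          *)
(* (real) deformation parameter.                                             *)

Section QuantumSU2.
Variable R : realType.
Local Notation C := R[i].

Definition conj_linear (V W : lmodType C) (f : V -> W) : Prop :=
  forall (c : C) (x y : V), f (c *: x + y) = (Num.conj c) *: f x + f y.

Record star_involution (A : algType C) (star : A -> A) : Prop := {
  star_conj_linear : conj_linear star;
  starM : forall x y, star (x * y) = star y * star x;
  starK : involutive star }.

Record suq2_relations (q : C) (A : algType C) (star : A -> A)
    (al ga : A) : Prop := {
  suq2_rel1 : star al * al + star ga * ga = 1;
  suq2_rel2 : al * star al + q ^+ 2 *: (ga * star ga) = 1;
  suq2_rel3 : ga * star ga = star ga * ga;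
  suq2_rel4 : al * ga = q *: (ga * al);
  suq2_rel5 : al * star ga = q *: (star ga * al) }.

Record suq2_algebra (q : C) (A : algType C) (star : A -> A)
    (al ga : A) : Prop := {
  suq2_star : star_involution star;
  suq2_rel : suq2_relations q star al ga;
  suq2_universal : forall (B : algType C) (starB : B -> B) (b c : B),
    star_involution starB -> suq2_relations q starB b c ->
    exists2 f : {lrmorphism A -> B},
      [/\ forall x, f (star x) = starB (f x), f al = b & f ga = c]
    & forall g : {lrmorphism A -> B},
        [/\ forall x, g (star x) = starB (g x), g al = b & g ga = c] ->
        g =1 f }.

(* T, with the elementary tensors tens a b, is the *-algebra A (x) A.        *)
Record tensor_square (A : algType C) (star : A -> A) (T : algType C)
    (starT : T -> T) (tens : {bilinear A -> A -> T}) : Prop := {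
  tensM : forall a b c e, tens a b * tens c e = tens (a * c) (b * e);
  tens1 : tens 1 1 = 1;
  tens_star_involution : star_involution starT;
  tens_star : forall a b, starT (tens a b) = tens (star a) (star b);
  tens_universal : forall (W : lmodType C) (f : {bilinear A -> A -> W}),
    exists2 g : {linear T -> W},
      forall a b, g (tens a b) = f a b
    & forall g' : {linear T -> W},
        (forall a b, g' (tens a b) = f a b) -> g' =1 g }.

Record suq2_comultiplication (q : C) (A : algType C) (star : A -> A)
    (al ga : A) (T : algType C) (starT : T -> T)
    (tens : {bilinear A -> A -> T}) (Delta : {lrmorphism A -> T}) : Prop := {
  comul_star : forall a, Delta (star a) = starT (Delta a);
  comul_al : Delta al = tens al al - q *: tens (star ga) ga;
  comul_ga : Delta ga = tens ga al + tens (star al) ga }.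

(* S plays the roles of the slice maps id (x) h and h (x) id, which exist    *)
(* and are unique by tens_universal.                                         *)
Record haar_integral (A T : algType C) (tens : {bilinear A -> A -> T})
    (Delta : {lrmorphism A -> T}) (h : {scalar A}) : Prop := {
  haar1 : h 1 = 1;
  haar_left : forall S : {linear T -> A},
    (forall a b, S (tens a b) = h b *: a) ->
    forall a, S (Delta a) = h a *: 1;
  haar_right : forall S : {linear T -> A},
    (forall a b, S (tens a b) = h a *: b) ->
    forall a, S (Delta a) = h a *: 1 }.

Section Calculus.
Variables (q : C) (A : algType C) (star : A -> A) (al ga : A).
Variables (Om : algType C) (iota : {lrmorphism A -> Om}) (e1 e2 e3 : Om).

Definition inv_basis (i : 'I_8) : Om :=
  [:: 1; e1; e2; e3; e1 * e2; e2 * e3; e3 * e1; e1 * e2 * e3]`_i.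

Definition inv_degree (i : 'I_8) : nat :=
  nth 0%N [:: 0; 1; 1; 1; 2; 2; 2; 3]%N i.

Definition left_invariant_form (w : Om) : Prop :=
  exists c : 'I_8 -> C, w = \sum_(i < 8) c i *: inv_basis i.

(* Om_k, the left A-span of the basis forms of degree k, is zero for k > 3.  *)
Definition form_of_degree (k : nat) (w : Om) : Prop :=
  exists a : 'I_8 -> A,
    w = \sum_(i < 8 | inv_degree i == k) iota (a i) * inv_basis i.

(* e * x = q^(-eps) x * e for x = al, ga; e * x = q^eps x * e for their stars *)
Definition eta_commutation (eps : nat) (e : Om) : Prop :=
  [/\ e * iota al = q ^- eps *: (iota al * e),
      e * iota ga = q ^- eps *: (iota ga * e),
      e * iota (star al) = q ^+ eps *: (iota (star al) * e)
    & e * iota (star ga) = q ^+ eps *: (iota (star ga) * e)].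

Record woronowicz_algebra : Prop := {
  (* Om is the direct sum of Om_0 = A, Om_1, Om_2, Om_3, and these are free  *)
  (* left A-modules on the basis forms of their degree.                      *)
  om_free : forall w : Om,
    exists! a : {ffun 'I_8 -> A}, w = \sum_(i < 8) iota (a i) * inv_basis i;
  om_graded : forall k l w1 w2, form_of_degree k w1 -> form_of_degree l w2 ->
    form_of_degree (k + l)%N (w1 * w2);
  eta11 : e1 ^+ 2 = 0;
  eta22 : e2 ^+ 2 = 0;
  eta33 : e3 ^+ 2 = 0;
  eta21 : e2 * e1 = - q ^+ 4 *: (e1 * e2);
  eta32 : e3 * e2 = - q ^+ 4 *: (e2 * e3);
  eta13 : e1 * e3 = - q ^- 2 *: (e3 * e1);
  eta1_comm : eta_commutation 1 e1;
  eta2_comm : eta_commutation 2 e2;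
  eta3_comm : eta_commutation 1 e3 }.

Record woronowicz_involution (starO : Om -> Om) : Prop := {
  starO_conj_linear : conj_linear starO;
  starOK : involutive starO;
  starO_iota : forall a, starO (iota a) = iota (star a);
  starO_degree : forall k w, form_of_degree k w -> form_of_degree k (starO w);
  starOM : forall k l w1 w2, form_of_degree k w1 -> form_of_degree l w2 ->
    starO (w1 * w2) = (-1) ^+ (k * l)%N *: (starO w2 * starO w1);
  starO_eta1 : starO e1 = q *: e3;
  starO_eta2 : starO e2 = - e2;
  starO_eta3 : starO e3 = q^-1 *: e1 }.

Record woronowicz_differential (starO : Om -> Om)
    (d : {linear Om -> Om}) : Prop := {
  d_degree : forall k w, form_of_degree k w -> form_of_degree k.+1 (d w);
  d_Leibniz : forall k w' w, form_of_degree k w' ->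
    d (w' * w) = d w' * w + (-1) ^+ k *: (w' * d w);
  d_square : forall w, d (d w) = 0;
  d_star : forall w, d (starO w) = starO (d w);
  d_al : d (iota al) = iota al * e2 - q ^+ 2 *: (iota (star ga) * e3);
  d_ga : d (iota ga) = iota ga * e2 + q *: (iota (star al) * e3);
  d_al_star : d (iota (star al)) =
    - q ^+ 2 *: (iota (star al) * e2) - iota ga * e1;
  d_ga_star : d (iota (star ga)) =
    - q ^+ 2 *: (iota (star ga) * e2) + q^-1 *: (iota al * e1);
  d_eta1 : d e1 = (q ^+ 2 * (1 + q ^+ 2)) *: (e1 * e2);
  d_eta2 : d e2 = q *: (e1 * e3);
  d_eta3 : d e3 = (q ^+ 2 * (1 + q ^+ 2)) *: (e2 * e3) }.

Definition inv_orthonormal_basis (i : 'I_8) : Om :=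
  [:: 1; e1; e2; e3; q ^- 7 *: (e1 * e2); q *: (e2 * e3);
      - q ^- 6 *: (e3 * e1); e1 * e2 * e3]`_i.

Record woronowicz_inner_product (h : {scalar A})
    (ip : {dot Om for Num.conj}) : Prop := {
  ip_left_invariant : forall (a b : A) (w w' : Om),
    left_invariant_form w -> left_invariant_form w' ->
    ip (iota a * w) (iota b * w') = h (star b * a) * ip w w';
  ip_orthonormal : forall i j : 'I_8,
    ip (inv_orthonormal_basis i) (inv_orthonormal_basis j) = (i == j)%:R }.

End Calculus.

Section Operators.
Variables (Om : lmodType C) (ip : {dot Om for Num.conj}).

Definition adjoint_of (S S' : Om -> Om) : Prop :=
  forall v w, ip (S v) w = ip v (S' w).

Definition form_norm (w : Om) : R := Num.sqrt (complex.Re (ip w w)).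

Definition bounded_operator (S : Om -> Om) : Prop :=
  exists M : R, forall w, form_norm (S w) <= M * form_norm w.

(* When nabla >= 0 has a basis of eigenvectors, these conditions pin down a  *)
(* unique linear S, namely R^s = (1 + nabla)^(- s / 2).                      *)
Definition resolvent_power (nabla : Om -> Om) (s : R) (S : Om -> Om) : Prop :=
  forall (t : R) (v : Om),
    nabla v = t%:C *: v -> S v = (powR (1 + t) (- (s / 2)))%:C *: v.

End Operators.

End QuantumSU2.

(* Main.v *)
Require Import Defs.
From HB Require Import structures.
From mathcomp Require Import all_boot all_order all_algebra.
From mathcomp Require Import sesquilinear complex reals exp.
From mathcomp Require Import boolp ring lra.

(* Give [alpha, gamma] degree [1], their adjoints degree [-1], and the basis  *)
(* forms weights such that [d] preserves the total weight. Let [c] be the     *)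
(* suitably normalized contraction with the vector field dual to [eta_2]. Then*)
(* [d c + c d] is the scalar [x_N = q^2 (q^(-2N) - 1) / (1 - q^2)] on forms of*)
(* total weight [N]; since [c] is bounded, [|x_N| |w| <= C (|d w| + |d^* w|)],*)
(* that is, [nabla] is at least a multiple of [x_N^2] on weight [N]. On the   *)
(* other hand [[d, L_a]] is multiplication by the 1-form [d a], whose norm on *)
(* weight [N] is [O(1 + |x_N|)] because [eta_r b] is [b eta_r] up to a power  *)
(* of [q] governed by the degree of [b]; [[d^*, L_a]] is treated by duality.  *)
(* So [R^beta] and [R^delta] absorb the growth on each weight space, and the  *)
(* weight spaces are pairwise orthogonal. To evaluate [R^s], one uses that    *)
(* [nabla] preserves the finite-dimensional spaces of forms whose coefficients*)
(* are words of bounded length: [d^*] does so because the Haar integral kills *)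
(* the image of the left-invariant vector fields.                             *)

(** The analysis is isolated in [weighted_commutator_bounded], a statement about any complex with
    orthogonal weight spaces preserved by [d]. Writing B for 1 + |x_N|, it combines three facts: 1 +
    nabla is at least a constant times B^2 on weight N ([spectral_gap]), the commutator is O(B)
    there ([K_bound]), and B changes at most by a constant factor when N is shifted by the degree of
    the multiplier. The two resolvent powers then contribute B^(-beta) and B^(-delta), which cancel
    B exactly because beta + delta = 1.

    For the calculus, the lower bound comes from the homotopy [contraction_Cartan]. It holds on all
    forms because the contraction is left linear over the coefficients and the eigenvalues [level]
    obey the cocycle rule [levelD]. The upper bound is [d_commutator_bounded], which rests on
    [iota_bounded] and [one_form_bounded].

    The powers of R are known only through their action on eigenvectors, so each weight vector must
    be a finite sum of eigenvectors of nabla. This is linear algebra ([locally_finite_decomposable])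
    once nabla is seen not to lengthen words, for which [weighted_dstar] computes the adjoint of
    [d]. That computation integrates the vector fields by parts ([vector_field_adjP]), starting from
    [haar_derivation]. *)

Set Implicit Arguments.
Unset Strict Implicit.
Unset Printing Implicit Defensive.

Import Order.TTheory GRing.Theory Num.Theory.

Local Open Scope ring_scope.
Local Open Scope complex_scope.

(** * Positive definite forms *)

Section DotNorm.
Variables (R : realType) (V : lmodType R[i]) (ip : {dot V for Num.conj}).
Implicit Types u v w : V.
Local Notation nrm := (form_norm ip).
Local Notation re := complex.Re.

Lemma re_conj (z : R[i]) : re (Num.conj z) = re z.
Proof. by apply: complexI; rewrite !complexRe Re_conj. Qed.

Lemma re_realM (x : R) (z : R[i]) : re (x%:C * z) = x * re z.
Proof. by case: z => a b /=; rewrite mul0r subr0. Qed.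

Lemma conj_realC (x : R) : Num.conj x%:C = x%:C :> R[i].
Proof. by apply: conj_Creal; apply/complex_realP; exists x. Qed.

Lemma ip_conj u v : ip u v = Num.conj (ip v u).
Proof. by rewrite hermC expr0 mul1r. Qed.

Lemma re_ipC u v : re (ip u v) = re (ip v u).
Proof. by rewrite ip_conj re_conj. Qed.

Lemma form_norm_ge0 w : 0 <= nrm w. Proof. exact: sqrtr_ge0. Qed.

Lemma ip_self w : ip w w = (nrm w ^+ 2)%:C.
Proof.
have h := dnorm_ge0 ip w; rewrite sqr_sqrtr; last first.
  by move: h; rewrite lecE => /andP[].
by rewrite RRe_real // ger0_real.
Qed.

Lemma re_ip_self w : re (ip w w) = nrm w ^+ 2.
Proof. by rewrite ip_self. Qed.

Lemma form_norm0 : nrm 0 = 0.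
Proof. by rewrite /form_norm linear0l sqrtr0. Qed.

Lemma form_norm_eq0 w : nrm w = 0 -> w = 0.
Proof.
move=> h; apply/eqP; rewrite -(dnorm_eq0 ip) ip_self h expr0n /=.
by rewrite raddf0.
Qed.

Lemma form_normZ (c : R[i]) w : nrm (c *: w) = Normc.normc c * nrm w.
Proof.
apply/eqP; rewrite -(eqrXn2 (n := 2)) ?form_norm_ge0 //; last first.
  by rewrite mulr_ge0 ?form_norm_ge0 //; case: (c) => a b; rewrite sqrtr_ge0.
apply/eqP/complexI; rewrite -ip_self dnormZ ip_self exprMn.
have -> : `|c| = (Normc.normc c)%:C by [].
by rewrite -rmorphXn -rmorphM.
Qed.

Lemma form_normZr (x : R) w : nrm (x%:C *: w) = `|x| * nrm w.
Proof. by rewrite form_normZ /= expr0n /= addr0 sqrtr_sqr. Qed.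

Lemma form_normN w : nrm (- w) = nrm w.
Proof. by rewrite /form_norm hnormN. Qed.

Lemma form_normD2 u v :
  nrm (u + v) ^+ 2 = nrm u ^+ 2 + nrm v ^+ 2 + 2 * re (ip u v).
Proof.
rewrite -!re_ip_self linearDl !linearDr /= !raddfD /= (re_ipC v u).
ring.
Qed.

Lemma form_normZ2 (x : R) w : nrm (x%:C *: w) ^+ 2 = x ^+ 2 * nrm w ^+ 2.
Proof. by rewrite form_normZr exprMn real_normK ?num_real. Qed.

Lemma form_CauchySchwarz u v : re (ip u v) <= nrm u * nrm v.
Proof.
have [/form_norm_eq0->|nu] := eqVneq (nrm u) 0.
  by rewrite linear0l form_norm0 mul0r.
have [/form_norm_eq0->|nv] := eqVneq (nrm v) 0.
  by rewrite linear0r form_norm0 mulr0.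
have pu : 0 < nrm u by rewrite lt_def nu form_norm_ge0.
have pv : 0 < nrm v by rewrite lt_def nv form_norm_ge0.
(* Expanding this square gives 2 |u| |v| (|u| |v| - Re (u, v)). *)
have h : 0 <= nrm ((nrm v)%:C *: u + (- nrm u)%:C *: v) ^+ 2 by rewrite sqr_ge0.
move: h; rewrite form_normD2 !form_normZ2 linearZl_LR linearZr_LR /= conj_realC.
rewrite !re_realM => h; have : 0 < nrm u * nrm v by rewrite mulr_gt0.
move: h; move: (nrm u) (nrm v) (re _) => a b c h p.
rewrite -subr_ge0 -(pmulr_rge0 _ p).
suff -> : a * b * (a * b - c) =
  2^-1 * (b ^+ 2 * a ^+ 2 + (- a) ^+ 2 * b ^+ 2 + 2 * (b * (- a * c))).
  by rewrite mulr_ge0 // invr_ge0.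
by field.
Qed.

Lemma form_CauchySchwarz_norm u v : `|re (ip u v)| <= nrm u * nrm v.
Proof.
rewrite ler_norml form_CauchySchwarz andbT lerNl -raddfN -linearNl /=.
by rewrite (le_trans (form_CauchySchwarz _ _)) // form_normN.
Qed.

Lemma ler_form_normD u v : nrm (u + v) <= nrm u + nrm v.
Proof.
rewrite -ler_sqr ?nnegrE ?addr_ge0 ?form_norm_ge0 // form_normD2 sqrrD.
have := form_CauchySchwarz u v; lra.
Qed.

Lemma ler_form_norm_sum (I : Type) (s : seq I) (P : pred I) (F : I -> V) :
  nrm (\sum_(i <- s | P i) F i) <= \sum_(i <- s | P i) nrm (F i).
Proof.
elim/big_rec2: _ => [|i y x _ h]; first by rewrite form_norm0.
by apply: (le_trans (ler_form_normD _ _)); rewrite lerD2l.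
Qed.

Lemma form_Pythagoras (I : eqType) (s : seq I) (F : I -> V) :
  uniq s -> (forall i j, i != j -> ip (F i) (F j) = 0) ->
  nrm (\sum_(i <- s) F i) ^+ 2 = \sum_(i <- s) nrm (F i) ^+ 2.
Proof.
move=> us o; elim: s us => [_|i s IH /= /andP[si us]].
  by rewrite !big_nil form_norm0 expr0n.
rewrite !big_cons form_normD2 IH // linear_sumr /=.
rewrite [X in re X]big_seq [X in re X]big1 ?mulr0 ?addr0 //.
by move=> j js; apply: o; apply: contraNneq si => ->.
Qed.

End DotNorm.

(** * Finite sums of vectors taken from a family of subspaces *)

Section OrthogonalDecomposition.
Variables (K : pzRingType) (V : lmodType K).

Definition subspace (P : V -> Prop) : Prop :=
  P 0 /\ forall c x y, P x -> P y -> P (c *: x + y).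

Lemma subspace0 P : subspace P -> P 0. Proof. by case. Qed.

Lemma subspaceD P x y : subspace P -> P x -> P y -> P (x + y).
Proof. by move=> [_ h] Px Py; rewrite -[x]scale1r; apply: h. Qed.

Lemma subspaceZ P c x : subspace P -> P x -> P (c *: x).
Proof. by move=> [p0 h] Px; rewrite -[_ *: _]addr0; apply: h. Qed.

Lemma subspaceB P x y : subspace P -> P x -> P y -> P (x - y).
Proof. by move=> sP Px Py; rewrite addrC -scaleN1r; apply: sP.2. Qed.

Lemma subspace_sum P (I : eqType) (s : seq I) (p : pred I) (F : I -> V) :
  subspace P -> (forall i, i \in s -> p i -> P (F i)) -> P (\sum_(i <- s | p i) F i).
Proof.
move=> sP h; rewrite big_seq_cond; elim/big_ind: _ => //.
- exact: subspace0.
- by move=> x y; apply: subspaceD.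
- by move=> i /andP[]; apply: h.
Qed.

Variables (I : eqType) (P : I -> V -> Prop).
Hypothesis subP : forall i, subspace (P i).

Definition decomposable (w : V) : Prop :=
  exists (s : seq I) (f : I -> V),
    [/\ uniq s, forall i, P i (f i) & w = \sum_(i <- s) f i].

(** Making the components vanish off the index list allows that list to be enlarged, so two
    decompositions can be added over a common one. *)
Lemma decomposable_supp w : decomposable w ->
  exists (s : seq I) (f : I -> V), [/\ uniq s, forall i, P i (f i),
    forall i, i \notin s -> f i = 0 & w = \sum_(i <- s) f i].
Proof.
move=> [s [f [us Pf ->]]]; exists s, (fun i => if i \in s then f i else 0).
split=> // [i|i /negPf->//|]; first by case: ifP => // _; apply: subspace0.
by apply: eq_big_seq => i ->.
Qed.

Lemma decomposable1 i w : P i w -> decomposable w.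
Proof.
move=> Pw; exists [:: i], (fun j => if j == i then w else 0); split=> //.
  by move=> j; case: eqP => [->//|_]; apply: subspace0.
by rewrite big_seq1 eqxx.
Qed.

Lemma decomposable_subspace : subspace decomposable.
Proof.
split=> [|c x y].
  by exists [::], (fun=> 0); split=> // [i|]; [apply: subspace0|rewrite big_nil].
move=> /decomposable_supp[s [f [us Pf f0 ->]]].
move=> /decomposable_supp[t [g [ut Pg g0 ->]]].
have aux (r r' : seq I) (h : I -> V) : uniq r -> uniq r' -> {subset r <= r'} ->
    (forall i, i \notin r -> h i = 0) -> \sum_(i <- r) h i = \sum_(i <- r') h i.
  move=> ur ur' sub h0; rewrite [RHS](bigID (mem r)) /= [X in _ + X]big1 ?addr0 //.
  rewrite -[RHS]big_filter; apply: perm_big; apply: uniq_perm => //.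
    exact: filter_uniq.
  move=> i; rewrite mem_filter; case ri: (i \in r) => //=.
  by rewrite (sub _ ri).
exists (undup (s ++ t)), (fun i => c *: f i + g i); split.
- exact: undup_uniq.
- by move=> i; apply: (subP i).2.
rewrite (aux s (undup (s ++ t))) ?undup_uniq //; last first.
  by move=> i si; rewrite mem_undup mem_cat si.
rewrite (aux t (undup (s ++ t))) ?undup_uniq //; last first.
  by move=> i si; rewrite mem_undup mem_cat si orbT.
by rewrite scaler_sumr -big_split.
Qed.

End OrthogonalDecomposition.

(** * Local spectral decomposition *)

Section Spectral.
Variables (R : realType) (V : lmodType R[i]) (ip : {dot V for Num.conj}).
Variables (T : {linear V -> V}) (W : V -> Prop).
Hypothesis T_selfadjoint : forall u v, ip (T u) v = ip u (T v).
Hypothesis W_subspace : subspace W.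
Hypothesis W_stable : forall w, W w -> W (T w).

Definition eigenvector_in (t : R) (v : V) : Prop := T v = t%:C *: v /\ W v.

Lemma eigenvector_in_subspace t : subspace (eigenvector_in t).
Proof.
split=> [|c x y [Tx Wx] [Ty Wy]].
  by split; [rewrite linear0 scaler0|apply: subspace0].
split; last exact: W_subspace.2.
by rewrite linearP Tx Ty scalerDr !scalerA mulrC.
Qed.

Lemma eigenvector_in_ortho s t u v :
  s != t -> eigenvector_in s u -> eigenvector_in t v -> ip u v = 0.
Proof.
move=> st [Tu _] [Tv _]; have := T_selfadjoint u v.
rewrite Tu Tv linearZl_LR linearZr_LR /= conj_realC => /eqP.
rewrite -subr_eq0 -mulrBl mulf_eq0 => /orP[|/eqP//].
by rewrite subr_eq0 => /eqP/complexI/eqP; rewrite (negPf st).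
Qed.

(** Removes one root z of an annihilating polynomial. The components of [T w - z *: w] with
    eigenvalue t different from z are divided by t - z and subtracted from w. What remains is v with
    [T v - z *: v = u] and [T u = z *: u]. If z is real, self-adjointness gives (u, u) = (v, (T - z)
    u) = 0, so there is no Jordan block. Otherwise u is an empty sum and v would have a non-real
    eigenvalue, so v = 0. *)
Lemma decomposable_step z w : W w ->
  decomposable eigenvector_in (T w - z *: w) -> decomposable eigenvector_in w.
Proof.
move=> Ww [s [f [us ef eqw]]].
have subd := decomposable_subspace eigenvector_in_subspace.
pose c (t : R) := (t%:C - z)^-1.
pose g := \sum_(t <- s | t%:C != z) c t *: f t.
pose u := \sum_(t <- s | t%:C == z) f t.
have dg : decomposable eigenvector_in g.
  apply: subspace_sum => // t _ _; apply: subspaceZ => //.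
  by apply: (@decomposable1 _ _ _ _ eigenvector_in_subspace t); apply: ef.
have Wg : W g.
  by apply: subspace_sum => // t _ _; apply: subspaceZ => //; case: (ef t).
have eqw' : T (w - g) - z *: (w - g) = u.
  have -> : T (w - g) - z *: (w - g) = (T w - z *: w) - (T g - z *: g).
    by rewrite linearB scalerBr !opprD !opprK addrACA.
  rewrite eqw (bigID (fun t : R => t%:C == z)) /= -/u -addrA.
  rewrite [X in _ + X](_ : _ = 0) ?addr0 // /g linear_sum scaler_sumr -sumrB.
  apply/eqP; rewrite subr_eq0; apply/eqP; apply: eq_bigr => t tz.
  rewrite linearZ /= (ef t).1 !scalerA -scalerBl [z * _]mulrC -mulrBr mulVf ?scale1r //.
  by rewrite subr_eq0.
suff dw : decomposable eigenvector_in (w - g).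
  by rewrite -(subrK g w); apply: subspaceD.
have Wwg : W (w - g) by apply: subspaceB.
move: (w - g) eqw' Wwg => v eqv Wv.
have Tu : T u = z *: u.
  rewrite linear_sum scaler_sumr; apply: eq_bigr => t /eqP <-.
  exact: (ef t).1.
have [zr|zr] := boolP (z \is Num.real).
  have /complex_realP[t0 zt] := zr.
  suff u0 : u = 0.
    apply: (@decomposable1 _ _ _ _ eigenvector_in_subspace t0); split=> //.
    by apply/eqP; rewrite -zt -subr_eq0 eqv u0.
  apply/eqP; rewrite -(dnorm_eq0 ip) -{1}eqv linearBl /= T_selfadjoint Tu zt.
  by rewrite linearZl_LR linearZr_LR /= conj_realC subrr.
have u0 : u = 0.
  rewrite /u big1 // => t /eqP tz; case/negP: zr.
  by apply/complex_realP; exists t.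
have Tv : T v = z *: v by apply/eqP; rewrite -subr_eq0 eqv u0.
suff -> : v = 0 by apply: subspace0.
apply/eqP; rewrite -(dnorm_eq0 ip); have := T_selfadjoint v v.
rewrite Tv linearZl_LR linearZr_LR /= => /eqP; rewrite -subr_eq0 -mulrBl mulf_eq0.
by case/orP=> //; rewrite subr_eq0 eq_sym -CrealE (negPf zr).
Qed.

Definition poly_act (p : {poly R[i]}) (w : V) : V :=
  \sum_(i < size p) p`_i *: iter i T w.

Lemma poly_act_wide n (p : {poly R[i]}) w : (size p <= n)%N ->
  poly_act p w = \sum_(i < n) p`_i *: iter i T w.
Proof.
move=> pn; rewrite /poly_act (big_ord_widen n (fun i => p`_i *: iter i T w)) //.
rewrite big_mkcond /=; apply: eq_bigr => i _; case: ltnP => // pi.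
by rewrite nth_default // scale0r.
Qed.

Lemma poly_act_mulXsubC (q : {poly R[i]}) z w :
  poly_act (q * ('X - z%:P)) w = poly_act q (T w - z *: w).
Proof.
have iterB i : iter i T (T w - z *: w) = iter i.+1 T w - z *: iter i T w.
  by elim: i => //= i ->; rewrite linearB linearZ.
rewrite (@poly_act_wide (size q).+1); last first.
  by rewrite (leq_trans (size_polyMleq _ _)) // size_XsubC addn2.
under eq_bigr => i _ do rewrite mulrBr coefB coefMX coefMC scalerBl.
rewrite sumrB big_ord_recl /= scale0r add0r [X in _ - X]big_ord_recr /=.
rewrite [q`_(size q)]nth_default // mul0r scale0r addr0 -sumrB.
apply: eq_bigr => i _; rewrite iterB scalerBr scalerA.
by congr (_ *: _ - _).
Qed.

(** Over the complex numbers p splits, and [decomposable_step] strips one linear factor at a time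
    until a nonzero constant is left. *)
Lemma poly_act0_decomposable (p : {poly R[i]}) w : p != 0 -> W w -> poly_act p w = 0 ->
  decomposable eigenvector_in w.
Proof.
have subd := decomposable_subspace eigenvector_in_subspace.
move: {2}(size p) (leqnn (size p)) => n.
elim: n p w => [|n IH] p w szp p0 Ww pw.
  by move: szp; rewrite leqn0 size_poly_eq0 (negPf p0).
have [sp1|sp1] := eqVneq (size p) 1%N.
  suff -> : w = 0 by apply: subspace0.
  move: pw p0; rewrite /poly_act -size_poly_eq0 sp1 big_ord1 /= => /eqP.
  rewrite scaler_eq0 => /orP[/eqP c0|/eqP//] _.
  by case/eqP/size_poly1P: sp1 c0 => c c1 ->; rewrite coefC /= => c0; rewrite c0 eqxx in c1.
have /closed_rootP[z /factor_theorem[q eqp]] := sp1.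
have q0 : q != 0 by apply: contraNneq p0 => q0; rewrite eqp q0 mul0r.
apply: (@decomposable_step z) => //; apply: (IH q) => //.
- by move: szp; rewrite eqp size_Mmonic ?monicXsubC // size_XsubC addn2.
- by apply: subspaceB => //; [apply: W_stable|apply: subspaceZ].
- by rewrite -poly_act_mulXsubC -eqp.
Qed.

(* Any [n + 1] vectors of the span of [n] vectors are linearly dependent. *)
Lemma locally_finite_decomposable (n : nat) (s : 'I_n -> V) (w : V) : W w ->
  (forall k, exists c : 'I_n -> R[i], iter k T w = \sum_(i < n) c i *: s i) ->
  decomposable eigenvector_in w.
Proof.
move=> Ww /choice[c hc].
pose M := (\matrix_(k < n.+1, i < n) c k i)%R.
have [u u0 uM] : exists2 u : 'rV_n.+1, u != 0 & u *m M = 0.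
  have : kermx M != 0.
    rewrite -mxrank_eq0 mxrank_ker subn_eq0 -ltnNge ltnS.
    exact: rank_leq_col.
  case/rowV0Pn=> u /sub_kermxP uM u0; by exists u.
pose p := \poly_(k < n.+1) u 0 (inord k).
have pE (k : 'I_n.+1) : p`_k = u 0 k by rewrite coef_poly ltn_ord inord_val.
apply: (@poly_act0_decomposable p) => //.
  apply: contraNneq u0 => p0; apply/eqP/rowP => k.
  by rewrite -pE p0 coef0 mxE.
rewrite (@poly_act_wide n.+1) ?size_poly //.
under eq_bigr => k _ do rewrite pE hc scaler_sumr.
rewrite exchange_big /= big1 // => i _.
under eq_bigr => k _ do rewrite scalerA.
rewrite -scaler_suml; have /rowP/(_ i) := uM; rewrite !mxE => h.
rewrite (_ : \sum_(k < n.+1) _ = 0) ?scale0r // -[RHS]h.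
by apply: eq_bigr => k _; rewrite mxE.
Qed.

(** On orthogonal eigenvectors [S] acts by scalars bounded by P^(-s/2), and Pythagoras adds up the
    components. *)
Lemma resolvent_power_bound (s P : R) (S : {linear V -> V}) (w : V) :
  resolvent_power T s S -> 0 <= s -> 0 < P ->
  (forall t v, eigenvector_in t v -> v != 0 -> P <= 1 + t) ->
  decomposable eigenvector_in w ->
  W (S w) /\ form_norm ip (S w) <= powR P (- (s / 2)) * form_norm ip w.
Proof.
move=> HS s0 P0 HP [r [f [ur ef ->]]].
have Sf t : S (f t) = (powR (1 + t) (- (s / 2)))%:C *: f t by apply: HS; case: (ef t).
rewrite linear_sum; split.
  apply: subspace_sum => // t _ _; rewrite Sf; apply: subspaceZ => //.
  exact: (ef t).2.
have o (t t' : R) : t != t' -> ip (f t) (f t') = 0.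
  by move=> tt'; apply: (eigenvector_in_ortho tt').
rewrite -ler_sqr ?nnegrE ?mulr_ge0 ?form_norm_ge0 ?powR_ge0 // exprMn.
rewrite !form_Pythagoras // => [|t t' tt']; last first.
  by rewrite !Sf linearZl_LR linearZr_LR /= o // !mulr0.
rewrite mulr_sumr; apply: ler_sum => t _; rewrite Sf form_normZ2.
(* The zero vector satisfies the eigenvalue equation for every t, so the lower bound on 1 + t is
   available only for nonzero components. *)
have [->|ft0] := eqVneq (f t) 0; first by rewrite form_norm0 expr0n !mulr0.
apply: ler_wpM2r; first exact: sqr_ge0.
rewrite ler_sqr ?nnegrE ?powR_ge0 //.
have Pt : P <= 1 + t by apply: HP ft0; apply: ef.
rewrite !powRN lef_pV2 ?posrE ?powR_gt0 ?(lt_le_trans P0) //.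
apply: ge0_ler_powR; rewrite ?nnegrE ?divr_ge0 ?(ltW P0) //.
exact: le_trans (ltW P0) Pt.
Qed.

End Spectral.

(** * Commutators on complexes graded by weights *)

Section WeightedComplex.
Variables (R : realType) (V : lmodType R[i]) (ip : {dot V for Num.conj}).
Variables (d dstar : {linear V -> V}) (W : int -> V -> Prop) (x : int -> R).
Hypothesis d_adjoint : adjoint_of ip d dstar.
Hypothesis d_square0 : forall w, d (d w) = 0.
Hypothesis W_subspace : forall N, subspace (W N).
Hypothesis W_ortho : forall N M u v, N != M -> W N u -> W M v -> ip u v = 0.
Hypothesis W_total : forall w, decomposable W w.
Hypothesis W_d : forall N w, W N w -> W N (d w).
Local Notation nrm := (form_norm ip).
Local Notation re := complex.Re.
Let D (w : V) : V := d w + dstar w.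
Let nabla (w : V) : V := D (D w).

Lemma ip_dstarl u v : ip (dstar u) v = ip u (d v).
Proof. by rewrite ip_conj -d_adjoint -ip_conj. Qed.

Lemma dstar_square0 w : dstar (dstar w) = 0.
Proof.
by apply/eqP; rewrite -(dnorm_eq0 ip) !ip_dstarl d_square0 linear0r.
Qed.

Lemma nablaE w : nabla w = d (dstar w) + dstar (d w).
Proof.
by rewrite /nabla /D !linearD /= d_square0 dstar_square0 add0r addr0 addrC.
Qed.

Lemma nabla_is_linear : linear nabla.
Proof. by move=> c u v; rewrite !nablaE !linearP /= scalerDr addrACA. Qed.

HB.instance Definition _ := GRing.isLinear.Build _ _ _ _ nabla nabla_is_linear.

Lemma nabla_selfadjoint u v : ip (nabla u) v = ip u (nabla v).
Proof. by rewrite !nablaE linearDl linearDr /= !(d_adjoint, ip_dstarl). Qed.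

(** Each component of u of weight M other than N pairs with u as with itself, so it vanishes. This
    makes [dstar] preserve weights without any formula for it. *)
Lemma W_projection N u :
  (forall M v, M != N -> W M v -> ip u v = 0) -> W N u.
Proof.
move=> ou; have [s [f [us Wf f0 eu]]] := decomposable_supp W_subspace (W_total u).
suff -> : u = f N by [].
have fM M : M != N -> f M = 0.
  move=> MN; have [/f0//|sM] := boolP (M \notin s).
  rewrite negbK in sM; apply/eqP; rewrite -(dnorm_eq0 ip).
  have := ou _ _ MN (Wf M); rewrite eu linear_sumlz (bigD1_seq M) //= big1 ?addr0.
    by move=> ->.
  by move=> i iM; apply: W_ortho iM _ _.
rewrite eu; have [sN|/f0 fN] := boolP (N \in s).
  by rewrite (bigD1_seq N) //= big1 ?addr0 // => i /fM.
by rewrite fN big1_seq // => i /andP[_ si]; have [->|/fM] := eqVneq i N.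
Qed.

Lemma W_dstar N w : W N w -> W N (dstar w).
Proof.
move=> Ww; apply: W_projection => M v MN Wv; rewrite ip_dstarl.
by apply: W_ortho Ww (W_d Wv); rewrite eq_sym.
Qed.

Lemma W_D N w : W N w -> W N (D w).
Proof. by move=> Ww; apply: subspaceD => //; [apply: W_d|apply: W_dstar]. Qed.

Lemma W_nabla N w : W N w -> W N (nabla w).
Proof. by move=> /W_D/W_D. Qed.

Hypothesis locally_finite : forall N w, W N w ->
  exists (n : nat) (s : 'I_n -> V), forall k, exists c : 'I_n -> R[i],
    iter k nabla w = \sum_(i < n) c i *: s i.

Lemma W_spectral N w : W N w -> decomposable (eigenvector_in nabla (W N)) w.
Proof.
move=> Ww; have [n [s hs]] := locally_finite Ww.
apply: (@locally_finite_decomposable R V ip nabla (W N) nabla_selfadjoint _ _ n s w Ww hs) => //.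
by move=> u; apply: W_nabla.
Qed.

Variables (contr : V -> V) (C : R).
Hypothesis C_ge0 : 0 <= C.
Hypothesis contr_bounded : forall w, nrm (contr w) <= C * nrm w.
Hypothesis Cartan_formula : forall N w, W N w ->
  d (contr w) + contr (d w) = (x N)%:C *: w.

(** [B N] is the growth of the commutator on weight N, and [P N] the lower bound for 1 + nabla
    there. Its constant comes from (1 + |x|)^2 <= 2 + 2 |x|^2 and |x|^2 <= 2 C^2 t for an eigenvalue
    t. *)
Let B N : R := 1 + `|x N|.
Let P N : R := B N ^+ 2 / (2 + 4 * C ^+ 2).

Let B_gt0 N : 0 < B N.
Proof. by rewrite ltr_pwDl. Qed.

Let c0_gt0 : 0 < 2 + 4 * C ^+ 2.
Proof. by rewrite ltr_pwDl // mulr_ge0 // sqr_ge0. Qed.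

Let P_gt0 N : 0 < P N.
Proof. by rewrite divr_gt0 // exprn_gt0. Qed.

(** Pair the Cartan formula with w, move the outer [d] to the other side as [dstar], apply
    Cauchy-Schwarz to both terms, and cancel one factor |w|. *)
Lemma x_bound N w : W N w -> `|x N| * nrm w <= C * (nrm (d w) + nrm (dstar w)).
Proof.
move=> Ww; have [w0|w0] := eqVneq (nrm w) 0.
  by rewrite w0 mulr0 mulr_ge0 ?addr_ge0 ?form_norm_ge0.
have pw : 0 < nrm w by rewrite lt_def w0 form_norm_ge0.
rewrite -(ler_pM2r pw) -mulrA -expr2.
have -> : `|x N| * nrm w ^+ 2 = `|re (ip ((x N)%:C *: w) w)|.
  by rewrite linearZl_LR /= re_realM re_ip_self normrM (ger0_norm (sqr_ge0 _)).
rewrite -Cartan_formula // linearDl raddfD /= d_adjoint.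
apply: (le_trans (ler_normD _ _)); rewrite addrC mulrDr mulrDl; apply: lerD.
  apply: (le_trans (form_CauchySchwarz_norm _ _ _)).
  by apply: ler_wpM2r; rewrite ?form_norm_ge0.
apply: (le_trans (form_CauchySchwarz_norm _ _ _)).
by rewrite mulrAC; apply: ler_wpM2r; rewrite ?form_norm_ge0.
Qed.

(** For an eigenvector, t |v|^2 = |d v|^2 + |d^* v|^2, which [x_bound] bounds below. *)
Lemma spectral_gap N t v : eigenvector_in nabla (W N) t v -> v != 0 ->
  P N <= 1 + t.
Proof.
move=> [nv0 Wv] v0; have nv : nabla v = t%:C *: v := nv0; have pv : 0 < nrm v.
  rewrite lt_def form_norm_ge0 andbT; apply: contra_neq v0.
  exact: form_norm_eq0.
have tE : t * nrm v ^+ 2 = nrm (d v) ^+ 2 + nrm (dstar v) ^+ 2.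
  rewrite -re_ip_self -re_realM -[_ * ip v v]linearZl_LR -nv nablaE linearDl raddfD /=.
  by rewrite ip_dstarl d_adjoint !re_ip_self addrC.
have h := x_bound Wv; set a := nrm (d v) in tE h; set b := nrm (dstar v) in tE h.
have [a0 b0] : 0 <= a /\ 0 <= b by rewrite !form_norm_ge0.
have p2 : 0 < nrm v ^+ 2 by rewrite exprn_gt0.
have t0 : 0 <= t by rewrite -(pmulr_lge0 _ p2) tE addr_ge0 ?sqr_ge0.
have h2 : `|x N| ^+ 2 <= 2 * C ^+ 2 * t.
  rewrite -(ler_pM2r p2) -[X in _ <= X]mulrA tE -exprMn.
  have : (`|x N| * nrm v) ^+ 2 <= (C * (a + b)) ^+ 2.
    by rewrite ler_sqr ?nnegrE ?mulr_ge0 ?addr_ge0 ?form_norm_ge0.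
  move=> /le_trans; apply; rewrite exprMn.
  have := mulr_ge0 (sqr_ge0 C) (sqr_ge0 (a - b)); nra.
rewrite ler_pdivrMr // /B.
have hC : 0 <= C ^+ 2 by rewrite sqr_ge0.
have hx := sqr_ge0 (1 - `|x N|).
nra.
Qed.

Lemma W_resolvent (s : R) (S : {linear V -> V}) N w :
  0 <= s -> resolvent_power nabla s S -> W N w ->
  W N (S w) /\ nrm (S w) <= powR (P N) (- (s / 2)) * nrm w.
Proof.
move=> s0 HS Ww.
apply: (resolvent_power_bound nabla_selfadjoint (W_subspace N) HS s0 (P_gt0 N)).
  by move=> t v; apply: spectral_gap.
exact: W_spectral.
Qed.

Variables (L L' : {linear V -> V}) (m : int) (C1 : R).
Hypothesis L_adjoint : adjoint_of ip L L'.
Hypothesis W_L : forall N w, W N w -> W (N + m) (L w).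
Hypothesis C1_ge0 : 0 <= C1.
Hypothesis L_commutator : forall N w, W N w ->
  nrm (d (L w) - L (d w)) <= C1 * (1 + `|x N|) * nrm w.
Hypothesis L'_commutator : forall N w, W N w ->
  nrm (d (L' w) - L' (d w)) <= C1 * (1 + `|x N|) * nrm w.
Variable C2 : R.
Hypothesis C2_gt0 : 0 < C2.
Hypothesis x_growth : forall N, 1 + `|x (N + m)| <= C2 * (1 + `|x N|).
Hypothesis x_growthV : forall N, 1 + `|x N| <= C2 * (1 + `|x (N + m)|).

Let K (w : V) : V := L (D w) - D (L w).

Lemma D_sum (I : Type) (s : seq I) (f : I -> V) :
  D (\sum_(i <- s) f i) = \sum_(i <- s) D (f i).
Proof. by rewrite /D !linear_sum big_split. Qed.

Lemma K_sum (I : Type) (s : seq I) (f : I -> V) :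
  K (\sum_(i <- s) f i) = \sum_(i <- s) K (f i).
Proof. by rewrite /K D_sum !linear_sum D_sum sumrB. Qed.

Lemma W_K N w : W N w -> W (N + m) (K w).
Proof.
move=> Ww; apply: subspaceB => //.
  by apply/W_L/W_D.
by apply/W_D/W_L.
Qed.

(** The part of K with [d] is bounded by hypothesis. The part z with [dstar] is treated by duality:
    |z|^2 is the pairing of w with the commutator of [d] and [L'] applied to z. Since z has weight N
    + m, [x_growth] is needed to return to weight N. *)
Lemma K_bound N w : W N w -> nrm (K w) <= (1 + C2) * C1 * B N * nrm w.
Proof.
move=> Ww; pose z := L (dstar w) - dstar (L w).
have -> : K w = - (d (L w) - L (d w)) + z.
  by rewrite /K /D linearD /= !opprD opprK addrACA [- _ + _]addrC.
apply: (le_trans (ler_form_normD _ _ _)); rewrite form_normN.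
have -> : (1 + C2) * C1 * B N * nrm w = C1 * B N * nrm w + C2 * (C1 * B N * nrm w).
  by ring.
apply: lerD; first exact: L_commutator.
have Wz : W (N + m) z.
  by apply: subspaceB => //; [apply/W_L/W_dstar|apply/W_dstar/W_L].
have [z0|z0] := eqVneq (nrm z) 0.
  rewrite z0 !mulr_ge0 ?form_norm_ge0 // ?ltW //.
have pz : 0 < nrm z by rewrite lt_def z0 form_norm_ge0.
rewrite -(ler_pM2r pz) -expr2 -re_ip_self.
have -> y : ip z y = ip w (d (L' y) - L' (d y)).
  rewrite /z linearBl linearBr /=.
  by rewrite L_adjoint !ip_dstarl L_adjoint.
apply: (le_trans (form_CauchySchwarz _ _ _)).
have h := L'_commutator Wz; have g := x_growth N.
apply: (@le_trans _ _ (nrm w * (C1 * (C2 * B N) * nrm z))).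
  apply: ler_wpM2l; first exact: form_norm_ge0.
  apply: (le_trans h); apply: ler_wpM2r; first exact: form_norm_ge0.
  by apply: ler_wpM2l.
by rewrite le_eqVlt; apply/orP; left; apply/eqP; ring.
Qed.

Variables (beta delta : R) (Rbeta Rdelta : {linear V -> V}).
Hypothesis beta_ge0 : 0 <= beta.
Hypothesis delta_ge0 : 0 <= delta.
Hypothesis beta_delta : beta + delta = 1.
Hypothesis Rbeta_power : resolvent_power nabla beta Rbeta.
Hypothesis Rdelta_power : resolvent_power nabla delta Rdelta.

Let M : R := powR (C2 ^- 2) (- (beta / 2)) * ((1 + C2) * C1 *
  Num.sqrt (2 + 4 * C ^+ 2)).

Let M_ge0 : 0 <= M.
Proof.
by rewrite !mulr_ge0 ?powR_ge0 ?sqrtr_ge0 ?addr_ge0 // ltW.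
Qed.

(** Up to constants the three factors contribute P^(-beta/2), P^(1/2) and P^(-delta/2) with P =
    [P N], and the exponents add up to 0. *)
Lemma W_commutator_bound N w : W N w ->
  W (N + m) (Rbeta (K (Rdelta w))) /\ nrm (Rbeta (K (Rdelta w))) <= M * nrm w.
Proof.
move=> Ww; have [Wu hu] := W_resolvent delta_ge0 Rdelta_power Ww.
have hk := K_bound Wu; have [Wb hb] := W_resolvent beta_ge0 Rbeta_power (W_K Wu).
split=> //; apply: (le_trans hb).
(* [Rbeta] acts on weight N + m. By [x_growthV], P (N + m) is at least P N / C2^2, and the negative
   exponent reverses the inequality. *)
have pP : powR (P (N + m)) (- (beta / 2)) <=
    powR (C2 ^- 2) (- (beta / 2)) * powR (P N) (- (beta / 2)).
  rewrite -powRM ?invr_ge0 ?exprn_ge0 ?(ltW C2_gt0) ?(ltW (P_gt0 _)) //.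
  rewrite !powRN lef_pV2 ?posrE ?powR_gt0 ?mulr_gt0 ?invr_gt0 ?exprn_gt0 //.
  apply: ge0_ler_powR; rewrite ?nnegrE ?(ltW (P_gt0 _)) //.
  - by rewrite divr_ge0.
  - by rewrite mulr_ge0 ?(ltW (P_gt0 _)) // invr_ge0 exprn_ge0 // ltW.
  rewrite mulrC ler_pdivrMr ?exprn_gt0 // /P [X in _ <= X]mulrAC ler_pM2r ?invr_gt0 //.
  rewrite mulrC -exprMn ler_sqr ?nnegrE ?(ltW (B_gt0 _)) ?x_growthV //.
  by rewrite mulr_ge0 ?(ltW C2_gt0) ?(ltW (B_gt0 _)).
have BE : B N = Num.sqrt (2 + 4 * C ^+ 2) * powR (P N) 2^-1.
  rewrite powR12_sqrt ?(ltW (P_gt0 _)) // -sqrtrM ?(ltW c0_gt0) //.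
  by rewrite /P mulrC divfK ?gt_eqF // sqrtr_sqr ger0_norm // ltW.
apply: (@le_trans _ _ (powR (C2 ^- 2) (- (beta / 2)) * powR (P N) (- (beta / 2)) *
   ((1 + C2) * C1 * B N * (powR (P N) (- (delta / 2)) * nrm w)))).
  apply: ler_pM; rewrite ?powR_ge0 ?form_norm_ge0 //.
  apply: (le_trans hk); apply: ler_wpM2l => //.
  by rewrite !mulr_ge0 ?addr_ge0 // ltW.
rewrite le_eqVlt; apply/orP; left; apply/eqP; rewrite BE /M.
have p1 : powR (P N) (- (beta / 2)) * powR (P N) 2^-1 * powR (P N) (- (delta / 2)) = 1.
  rewrite -!powRD ?[P N == 0]gt_eqF ?implybT //.
  rewrite (_ : - (beta / 2) + 2^-1 + - (delta / 2) = 0) ?powRr0 //.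
  by have := beta_delta; lra.
have := congr1 (fun y => M * nrm w * y) p1; rewrite /M mulr1 => <-; ring.
Qed.

(** The operator shifts every weight by m, so images of distinct weight spaces stay orthogonal.
    Pythagoras before and after the operator turns the uniform bound on weight spaces into a global
    one. *)
Theorem weighted_commutator_bounded :
  bounded_operator ip (fun w => Rbeta (K (Rdelta w))).
Proof.
exists M => w; have [s [f [us Wf ->]]] := W_total w.
have -> : Rbeta (K (Rdelta (\sum_(i <- s) f i))) = \sum_(i <- s) Rbeta (K (Rdelta (f i))).
  by rewrite linear_sum K_sum linear_sum.
rewrite -ler_sqr ?nnegrE ?(mulr_ge0 M_ge0) ?form_norm_ge0 // exprMn.
have o i j : i != j -> ip (f i) (f j) = 0 by move=> ij; apply: W_ortho ij _ _.
rewrite !form_Pythagoras // => [|i j ij]; last first.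
  apply: (@W_ortho (i + m) (j + m)).
  - by rewrite (inj_eq (addIr _)).
  - by case: (W_commutator_bound (Wf i)).
  - by case: (W_commutator_bound (Wf j)).
rewrite mulr_sumr; apply: ler_sum => i _; rewrite -exprMn.
rewrite ler_sqr ?nnegrE ?(mulr_ge0 M_ge0) ?form_norm_ge0 //.
by case: (W_commutator_bound (Wf i)).
Qed.

End WeightedComplex.

(** * Generation of A_q *)

Section Generation.
Variables (R : realType) (q : R[i]) (A : algType R[i]) (star : A -> A) (al ga : A).
Hypothesis HA : suq2_algebra q star al ga.

Let starK : involutive star := starK (suq2_star HA).
Let starM x y : star (x * y) = star y * star x.
Proof. exact: starM (suq2_star HA) x y. Qed.

Lemma star_linearP (c : R[i]) x y :
  star (c *: x + y) = Num.conj c *: star x + star y.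
Proof. exact: star_conj_linear (suq2_star HA) c x y. Qed.

Lemma star0 : star 0 = 0.
Proof.
have := star_linearP 1 0 0; rewrite rmorph1 !scale1r addr0 => /eqP.
by rewrite addrC -subr_eq subrr eq_sym => /eqP.
Qed.

Lemma star1 : star 1 = 1.
Proof. by rewrite -[LHS]mulr1 -[X in _ * X]starK -starM mulr1 starK. Qed.

Lemma starD x y : star (x + y) = star x + star y.
Proof. by have := star_linearP 1 x y; rewrite rmorph1 !scale1r. Qed.

Lemma starZ c x : star (c *: x) = Num.conj c *: star x.
Proof. by have := star_linearP c x 0; rewrite star0 !addr0. Qed.

Variable P : A -> Prop.
Hypothesis P1 : P 1.
Hypothesis P_linear : forall c x y, P x -> P y -> P (c *: x + y).
Hypothesis PM : forall x y, P x -> P y -> P (x * y).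
Hypothesis P_gen : [/\ P al, P ga, P (star al) & P (star ga)].

(** Asking for [P] of the adjoint as well makes this a star-subalgebra, to which the universal
    property can be applied. *)
Let Q : {pred A} := [pred x | `[< P x /\ P (star x) >]].

Let inQ x : x \in Q <-> P x /\ P (star x).
Proof. by rewrite inE; split=> [/asboolP|/asboolP]. Qed.

Let Q_closed : subalg_closed Q.
Proof.
split.
- by apply/inQ; rewrite star1.
- move=> c x y /inQ[Px Psx] /inQ[Py Psy]; apply/inQ.
  by rewrite star_linearP; split; apply: P_linear.
- move=> x y /inQ[Px Psx] /inQ[Py Psy]; apply/inQ.
  by rewrite starM; split; apply: PM.
Qed.

HB.instance Definition _ := GRing.isSubalgClosed.Build R[i] A Q
  (GRing.subalg_closed_semi Q_closed).

Record good := Good { good_val : A; _ : good_val \in Q }.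

HB.instance Definition _ := [isSub for good_val].
HB.instance Definition _ := [Choice of good by <:].
HB.instance Definition _ := [SubChoice_isSubAlgebra of good by <:].

Let star_in (x : good) : star (val x) \in Q.
Proof. by apply/inQ; rewrite starK; case/inQ: (valP x). Qed.

Let starG (x : good) : good := Good (star_in x).

Let starG_involution : star_involution starG.
Proof.
split.
- by move=> c x y; apply: val_inj; rewrite /= star_linearP.
- by move=> x y; apply: val_inj; rewrite /= starM.
- by move=> x; apply: val_inj; rewrite /= starK.
Qed.

Let incl (f : {lrmorphism A -> good}) (x : A) : A := good_val (f x).

Let incl_linear f : linear (incl f).
Proof. by move=> c x y; rewrite /incl linearP. Qed.

Let incl_monoid f : monoid_morphism (incl f).
Proof. by split=> [|x y]; rewrite /incl ?rmorph1 ?rmorphM. Qed.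

HB.instance Definition _ f := GRing.isLinear.Build _ _ _ _ (incl f) (incl_linear f).
HB.instance Definition _ f :=
  GRing.isMonoidMorphism.Build _ _ (incl f) (incl_monoid f).

(* By uniqueness in the universal property, the inclusion of the subalgebra   *)
(* of the elements that satisfy [P] with their adjoints has a section.        *)
Lemma suq2_ind x : P x.
Proof.
have [Pal Pga Psal Psga] := P_gen.
have Qal : al \in Q by apply/inQ.
have Qga : ga \in Q by apply/inQ.
have rel : suq2_relations q starG (Good Qal) (Good Qga).
  have [h1 h2 h3 h4 h5] := suq2_rel HA.
  by split; apply: val_inj.
have [f [f_star f_al f_ga] _] := suq2_universal HA starG_involution rel.
have [g _ g_uniq] := suq2_universal HA (suq2_star HA) (suq2_rel HA).
have e1 : incl f x = g x.
  apply: g_uniq; split; rewrite /= /incl ?f_al ?f_ga // => y.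
  by rewrite /= f_star.
have e2 : x = g x by apply: (g_uniq idfun).
by case/inQ: (valP (f x)) => + _; rewrite -[val (f x)]/(incl f x) e1 -e2.
Qed.

End Generation.

(** * The calculus on left-invariant forms *)

Section Forms.
Variables (R : realType) (q : R).
Hypotheses (q_neq0 : 0 < `|q|) (q_lt1 : `|q| < 1).
Variables (A : algType R[i]) (star : A -> A) (al ga : A).
Variables (Om : algType R[i]) (iota : {lrmorphism A -> Om}) (e1 e2 e3 : Om).
Local Notation qc := (q%:C : R[i]).
Hypothesis HOm : woronowicz_algebra qc star al ga iota e1 e2 e3.

Definition one_form (k : nat) : Om := [:: e1; e2; e3]`_k.
Definition inv_form (i : nat) : Om :=
  [:: 1; e1; e2; e3; e1 * e2; e2 * e3; e3 * e1; e1 * e2 * e3]`_i.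

(* The product [one_form k * inv_form i] and the differential of [inv_form i] *)
(* are multiples of basis forms: see [eta_mul] and [d_form].                  *)
Definition mul_coef (k i : nat) : R[i] :=
  (nth [::] [:: [:: 1; 0; 1; - qc ^- 2; 0; 1; 0; 0];
                [:: 1; - qc ^+ 4; 0; 1; 0; 0; qc ^+ 6; 0];
                [:: 1; 1; - qc ^+ 4; 0; qc ^+ 6; 0; 0; 0]] k)`_i.
Definition mul_index (k i : nat) : nat :=
  nth 0%N (nth [::] [:: [:: 1; 0; 4; 6; 0; 7; 0; 0];
                        [:: 2; 4; 0; 5; 0; 0; 7; 0];
                        [:: 3; 6; 5; 0; 7; 0; 0; 0]]%N k) i.
Definition d_coef (i : nat) : R[i] :=
  [:: 0; qc ^+ 2 * (1 + qc ^+ 2); - qc^-1; qc ^+ 2 * (1 + qc ^+ 2)]`_i.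
Definition d_index (i : nat) : nat := nth 0%N [:: 0; 4; 6; 5]%N i.

(** The 1-forms have weights -2, 0, 2, forced by terms such as [star ga * e3] in [d al] and
    [ga * e1] in [d (star al)]; products add weights. *)
Definition form_weight (i : nat) : int := nth 0 [:: 0; -2; 0; 2; -2; 2; 0; 0] i.
Definition eta_weight (k : nat) : int := form_weight k.+1.

Lemma qc_neq0 : qc != 0.
Proof. by rewrite fmorph_eq0 -normr_gt0. Qed.

Lemma eta_form k : one_form k = inv_form (if (k < 3)%N then k.+1 else 8).
Proof. by case: k => [|[|[|k]]]; rewrite /one_form /inv_form //= nth_nil. Qed.

Lemma eta_mul k i :
  one_form k * inv_form i = mul_coef k i *: inv_form (mul_index k i).
Proof.
have e11 : e1 * e1 = 0 by rewrite -expr2; exact: eta11 HOm.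
have e22 : e2 * e2 = 0 by rewrite -expr2; exact: eta22 HOm.
have e33 : e3 * e3 = 0 by rewrite -expr2; exact: eta33 HOm.
have e21 := eta21 HOm; have e32 := eta32 HOm; have e13 := eta13 HOm.
have q0 := qc_neq0.
have e31 : e3 * e1 = - qc ^+ 2 *: (e1 * e3).
  by rewrite e13 scalerA mulrNN mulfV ?scale1r // expf_neq0.
have e312 : e3 * (e1 * e2) = qc ^+ 6 *: (e1 * e2 * e3).
  rewrite mulrA e31 -scalerAl -[e1 * e3 * e2]mulrA e32 -scalerAr scalerA mulrA.
  by congr (_ *: _); ring.
have e231 : e2 * (e3 * e1) = qc ^+ 6 *: (e1 * e2 * e3).
  rewrite e31 -scalerAr mulrA e21 -!scalerAl scalerA.
  by congr (_ *: _); ring.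
have e121 : e1 * (e3 * e1) = 0 by rewrite mulrA e13 -scalerAl -mulrA e11 mulr0 scaler0.
have e212 : e2 * (e1 * e2) = 0 by rewrite mulrA e21 -scalerAl -mulrA e22 mulr0 scaler0.
have e323 : e3 * (e2 * e3) = 0 by rewrite mulrA e32 -scalerAl -mulrA e33 mulr0 scaler0.
have e1123 : e1 * (e1 * e2 * e3) = 0 by rewrite !mulrA e11 !mul0r.
have e2123 : e2 * (e1 * e2 * e3) = 0 by rewrite mulrA e212 mul0r.
have e3123 : e3 * (e1 * e2 * e3) = 0.
  by rewrite mulrA e312 -scalerAl -[_ * e3 * e3]mulrA e33 mulr0 scaler0.
have e112 : e1 * (e1 * e2) = 0 by rewrite mulrA e11 mul0r.
have e223 : e2 * (e2 * e3) = 0 by rewrite mulrA e22 mul0r.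
have e331 : e3 * (e3 * e1) = 0 by rewrite mulrA e33 mul0r.
case: k => [|[|[|k]]]; last first.
- by rewrite /one_form /mul_coef /= !nth_nil mul0r scale0r.
all: case: i => [|[|[|[|[|[|[|[|i]]]]]]]];
  rewrite /one_form /inv_form /mul_coef /mul_index /= ?nth_nil ?mulr0 ?scale0r ?scale1r ?mulr1 //.
by rewrite mulrA.
Qed.

Definition form_coef (w : Om) : {ffun 'I_8 -> A} := projT1 (cid (om_free HOm w)).

Lemma form_coefE w : w = \sum_(i < 8) iota (form_coef w i) * inv_form i.
Proof. by rewrite {1}(projT2 (cid (om_free HOm w))).1. Qed.

Lemma form_coef_unique (a : 'I_8 -> A) w :
  w = \sum_(i < 8) iota (a i) * inv_form i -> forall i, form_coef w i = a i.
Proof.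
move=> wE i; rewrite /form_coef; case: (cid _) => c /= [_ c_uniq].
rewrite (c_uniq [ffun j => a j]) ?ffunE //.
by rewrite wE; apply: eq_bigr => j _; rewrite ffunE.
Qed.

Lemma form_coef_linear i : linear (form_coef ^~ i).
Proof.
move=> c x y /=; apply: (@form_coef_unique (fun i => c *: form_coef x i + form_coef y i)).
rewrite {1}(form_coefE x) {1}(form_coefE y) scaler_sumr -big_split /=.
by apply: eq_bigr => j _; rewrite linearP mulrDl scalerAl.
Qed.

Lemma form_coef_iota a w i : form_coef (iota a * w) i = a * form_coef w i.
Proof.
apply: (@form_coef_unique (fun i => a * form_coef w i)); rewrite {1}(form_coefE w) mulr_sumr.
by apply: eq_bigr => j _; rewrite rmorphM mulrA.
Qed.

Lemma iota_form_sum (i : 'I_8) a :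
  iota a * inv_form i = \sum_(j < 8) iota (if j == i then a else 0) * inv_form j.
Proof.
rewrite (bigD1 i) //= eqxx big1 ?addr0 // => j /negPf ->.
by rewrite raddf0 mul0r.
Qed.

Lemma form_coef_form (i j : 'I_8) a : form_coef (iota a * inv_form i) j = if j == i then a else 0.
Proof. exact: form_coef_unique (iota_form_sum i a) j. Qed.

Lemma form_degree (i : 'I_8) a :
  form_of_degree iota e1 e2 e3 (inv_degree i) (iota a * inv_form i).
Proof.
exists (fun j => if j == i then a else 0).
rewrite (bigD1 i) //= eqxx big1 ?addr0 // => j /andP[_ /negPf ->].
by rewrite raddf0 mul0r.
Qed.

Lemma iota_degree a : form_of_degree iota e1 e2 e3 0 (iota a).
Proof. by have := form_degree 0 a; rewrite /inv_form /= mulr1. Qed.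

Lemma eta_degree k : form_of_degree iota e1 e2 e3 1 (one_form k).
Proof.
case: k => [|[|[|k]]].
- by have := form_degree 1 1; rewrite rmorph1 mul1r.
- by have := form_degree 2 1; rewrite rmorph1 mul1r.
- by have := form_degree 3 1; rewrite rmorph1 mul1r.
- exists (fun=> 0); rewrite /one_form /= nth_nil big1 // => i _.
  by rewrite raddf0 mul0r.
Qed.

Variables (starO : Om -> Om) (d : {linear Om -> Om}).
Hypothesis Hd : woronowicz_differential qc star al ga iota e1 e2 e3 starO d.

Lemma d_iota a w : d (iota a * w) = d (iota a) * w + iota a * d w.
Proof. by rewrite (d_Leibniz Hd _ (iota_degree a)) expr0 scale1r. Qed.

Lemma d_one : d 1 = 0.
Proof.
have := d_iota 1 1; rewrite rmorph1 !mul1r mulr1 => /eqP.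
by rewrite -subr_eq subrr eq_sym => /eqP.
Qed.

Lemma d_eta k w : d (one_form k * w) = d (one_form k) * w - one_form k * d w.
Proof. by rewrite (d_Leibniz Hd _ (eta_degree k)) expr1 scaleN1r. Qed.

Lemma d_form i : d (inv_form i) = d_coef i *: inv_form (d_index i).
Proof.
have q0 := qc_neq0; have m k i := eta_mul k i.
have de1 : d (one_form 0) = (qc ^+ 2 * (1 + qc ^+ 2)) *: inv_form 4 := d_eta1 Hd.
have de2 : d (one_form 1) = - qc^-1 *: inv_form 6.
  rewrite [LHS](d_eta2 Hd) (eta13 HOm) scalerA; congr (_ *: _).
  by field.
have de3 : d (one_form 2) = (qc ^+ 2 * (1 + qc ^+ 2)) *: inv_form 5 := d_eta3 Hd.
have d12 : d (inv_form 4) = 0.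
  rewrite (_ : inv_form 4 = one_form 0 * one_form 1) // d_eta de1 de2 -scalerAl -scalerAr.
  have -> : inv_form 4 * one_form 1 = 0.
    by rewrite /inv_form /one_form /= -mulrA -expr2 (eta22 HOm) mulr0.
  by rewrite [_ * inv_form 6](m 0 6) /mul_coef /= scale0r !scaler0 subrr.
have d23 : d (inv_form 5) = 0.
  rewrite (_ : inv_form 5 = one_form 1 * one_form 2) // d_eta de3 de2 -scalerAl -scalerAr.
  have -> : inv_form 6 * one_form 2 = 0.
    have := eta13 HOm; rewrite /inv_form /one_form /= => e13.
    have -> : e3 * e1 = - qc ^+ 2 *: (e1 * e3).
      by rewrite e13 scalerA mulrNN mulfV ?scale1r // expf_neq0.
    by rewrite -scalerAl -mulrA -expr2 (eta33 HOm) mulr0 scaler0.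
  by rewrite [_ * inv_form 5](m 1 5) /mul_coef /= scale0r !scaler0 subrr.
case: i => [|[|[|[|[|[|[|[|i]]]]]]]]; rewrite /d_coef /d_index /= ?nth_nil ?scale0r //.
- exact: d_one.
- rewrite (_ : inv_form 6 = one_form 2 * one_form 0) // d_eta de1 de3 -scalerAl -scalerAr.
  have -> : inv_form 5 * one_form 0 = one_form 1 * inv_form 6.
    by rewrite /inv_form /one_form /= mulrA.
  by rewrite (m 1 6) (m 2 4) /mul_coef /mul_index /= subrr.
- have -> : inv_form 7 = one_form 0 * inv_form 5 by rewrite /inv_form /one_form /= mulrA.
  rewrite d_eta d23 de1 mulr0 subr0 -scalerAl /inv_form /= mulrA -[e1 * e2 * e2]mulrA.
  by rewrite -expr2 (eta22 HOm) mulr0 mul0r scaler0.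
- by rewrite /inv_form /= nth_nil linear0.
Qed.

(** * Contraction and the Cartan formula on invariant forms *)

Definition contr_coef (i : nat) : R[i] := [:: 0; 0; 1; 0; -1; qc ^- 4; 0; qc ^- 6]`_i.
Definition contr_index (i : nat) : nat := nth 0%N [:: 0; 0; 0; 0; 1; 3; 0; 6]%N i.

(* Contraction with the vector field dual to [e2]; [contr_coef] is chosen so  *)
(* that [contraction_Cartan] holds.                                           *)
Definition contraction (w : Om) : Om :=
  \sum_(i < 8) iota (form_coef w i) * (contr_coef i *: inv_form (contr_index i)).

Lemma contraction_linear : linear contraction.
Proof.
move=> c x y; rewrite /contraction scaler_sumr -big_split /=.
apply: eq_bigr => i _; have -> := form_coef_linear i c x y.
by rewrite linearP mulrDl scalerAl.
Qed.

HB.instance Definition _ := GRing.isLinear.Build _ _ _ _ contraction contraction_linear.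

Lemma contractionZ c w : contraction (c *: w) = c *: contraction w.
Proof. exact: linearZ. Qed.

Lemma contraction_iota a w : contraction (iota a * w) = iota a * contraction w.
Proof.
rewrite /contraction mulr_sumr; apply: eq_bigr => i _.
by rewrite form_coef_iota rmorphM mulrA.
Qed.

Lemma contraction_form i :
  contraction (inv_form i) = contr_coef i *: inv_form (contr_index i).
Proof.
have [i8|i8] := ltnP i 8; last first.
  have -> : contr_coef i = 0 by rewrite [LHS]nth_default.
  by rewrite [inv_form i]nth_default // linear0 scale0r.
rewrite (_ : i = Ordinal i8 :> nat) //; move: (Ordinal i8) => {i8}i.
rewrite /contraction (bigD1 i) //= big1 => [|j ji].
  by have := form_coef_form i i 1; rewrite rmorph1 mul1r eqxx => ->; rewrite rmorph1 mul1r addr0.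
by have := form_coef_form i j 1; rewrite rmorph1 mul1r (negPf ji) => ->; rewrite raddf0 mul0r.
Qed.

(* The eigenvalue of the second vector field on elements of degree [n].       *)
Definition level (n : int) : R := q ^+ 2 * (q ^ (-2 * n) - 1) / (1 - q ^+ 2).

Lemma one_sub_q2_neq0 : 1 - q ^+ 2 != 0.
Proof.
rewrite subr_eq0 eq_sym; apply: contraTneq q_lt1 => q2; rewrite -leNgt.
by rewrite -(ler_sqr (R := R)) ?nnegrE // expr1n real_normK ?num_real // q2.
Qed.

Lemma q_unit : q \is a GRing.unit.
Proof. by rewrite unitfE -normr_gt0. Qed.

(** A twisted cocycle rule, reflecting the Leibniz rule of the second vector field: moving [e2] past
    an element of degree m costs q^(-2m). *)
Lemma levelD n m : level (n + m) = q ^ (-2 * m) * level n + level m.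
Proof.
rewrite /level (_ : -2 * (n + m) = -2 * n + -2 * m); last by ring.
rewrite exprzDr ?q_unit //; have := one_sub_q2_neq0.
by move=> ?; field.
Qed.

Lemma real_expz n : (q ^ n)%:C = qc ^ n.
Proof. by case: n => n; rewrite /exprz /= ?rmorphXn ?fmorphV ?rmorphXn. Qed.

(** A Clifford relation: contraction anticommutes with [e1] and [e3] and pairs with [e2]. The factor
    for [e2] is the one in [levelD], so the degree of a coefficient and the weight of its form
    combine into the total weight. *)
Lemma contr_eta_form (k : 'I_3) i : (i < 8)%N ->
  one_form k * contraction (inv_form i) + contraction (one_form k * inv_form i) =
  if k == 1 :> nat then (q ^ (-2 * form_weight i))%:C *: inv_form i else 0.
Proof.
have q0 := qc_neq0; rewrite real_expz => i8.
have hp : qc ^ (-2 * -2) = qc ^+ 4 by [].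
have hm : qc ^ (-2 * 2) = qc ^- 4 by [].
rewrite contraction_form -scalerAr !eta_mul contractionZ contraction_form !scalerA.
case: k => [[|[|[|k]]] //= _]; case: i i8 => [|[|[|[|[|[|[|[|i]]]]]]]] //= _;
  rewrite /contr_coef /contr_index /mul_coef /mul_index /form_weight /=
    ?(mulr0, mul0r, scale0r, addr0, add0r) //.
all: rewrite -?scalerDl ?expr0z ?hp ?hm.
all: try by congr (_ *: _); field.
all: by rewrite [X in X *: _](_ : _ = 0) ?scale0r //; field.
Qed.

Lemma d_contr_form i : (i < 8)%N ->
  d (contraction (inv_form i)) + contraction (d (inv_form i)) =
  (level (form_weight i))%:C *: inv_form i.
Proof.
have q0 := qc_neq0; have q0' : q != 0 by rewrite -normr_gt0.
have q21 := one_sub_q2_neq0.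
have l0 : level 0 = 0 by rewrite /level mulr0 expr0z subrr mulr0 mul0r.
have lN : (level (-2))%:C = - (qc ^+ 2 * (1 + qc ^+ 2)).
  have -> : level (-2) = - (q ^+ 2 * (1 + q ^+ 2)).
    by rewrite /level (_ : q ^ (-2 * -2) = q ^+ 4) //; field.
  by rewrite rmorphN rmorphM rmorphD rmorphXn rmorph1.
have lP : (level 2)%:C = qc ^- 2 * (1 + qc ^+ 2).
  have -> : level 2 = q ^- 2 * (1 + q ^+ 2).
    rewrite /level (_ : q ^ (-2 * 2) = q ^- 4) //; field.
    by rewrite q0' q21.
  by rewrite rmorphM rmorphD fmorphV rmorphXn rmorph1.
move=> i8; rewrite d_form contraction_form contractionZ linearZ /= d_form contraction_form !scalerA.
case: i i8 => [|[|[|[|[|[|[|[|i]]]]]]]] //= _;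
  rewrite /contr_coef /contr_index /d_coef /d_index /form_weight /=
    ?l0 ?lN ?lP ?(mulr0, mul0r, scale0r, addr0, add0r) //.
all: by congr (_ *: _); field.
Qed.
End Forms.

(** * Homogeneous elements of A_q *)

Section Homogeneous.
Variables (R : realType) (q : R).
Hypotheses (q_neq0 : 0 < `|q|) (q_lt1 : `|q| < 1).
Variables (A : algType R[i]) (star : A -> A) (al ga : A).
Local Notation qc := (q%:C : R[i]).
Hypothesis HA : suq2_algebra qc star al ga.

Inductive letter : int -> A -> Prop :=
| letter_al : letter 1 al
| letter_ga : letter 1 ga
| letter_als : letter (-1) (star al)
| letter_gas : letter (-1) (star ga).

(* The span of the words of length at most [m] and degree [n]. *)
Inductive word_span : nat -> int -> A -> Prop :=
| word_span_one m : word_span m 0 1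
| word_span_zero m n : word_span m n 0
| word_span_linear m n c x y : word_span m n x -> word_span m n y -> word_span m n (c *: x + y)
| word_span_letterM m n k g x : letter n g -> word_span m k x -> word_span m.+1 (n + k) (g * x).

Lemma word_span_subspace m n : subspace (word_span m n).
Proof. by split=> [|c x y]; [exact: word_span_zero|exact: word_span_linear]. Qed.

Lemma word_span_widen m m' n a : (m <= m')%N -> word_span m n a -> word_span m' n a.
Proof.
move=> mm' ha; elim: ha m' mm' => {m n a}.
- by move=> m m' _; apply: word_span_one.
- by move=> m n m' _; apply: word_span_zero.
- by move=> m n c x y _ IHx _ IHy m' mm'; apply: word_span_linear; [apply: IHx|apply: IHy].
- by move=> m n k g x lg _ IH [//|m'] mm'; apply: word_span_letterM => //; apply: IH.
Qed.

Lemma word_spanM m m' n n' a b : word_span m n a -> word_span m' n' b ->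
  word_span (m + m') (n + n') (a * b).
Proof.
move=> ha hb; elim: ha => {m n a}.
- by move=> m; rewrite add0r mul1r; apply: word_span_widen hb; apply: leq_addl.
- by move=> m n; rewrite mul0r; apply: word_span_zero.
- by move=> m n c x y _ hx _ hy; rewrite mulrDl -scalerAl; apply: word_span_linear.
- by move=> m n k g x lg _ h; rewrite -mulrA -addrA addSn; apply: word_span_letterM.
Qed.

Lemma letter_hom n g : letter n g -> word_span 1 n g.
Proof.
move=> lg; rewrite -[n]addr0 -[g]mulr1; apply: word_span_letterM => //.
exact: word_span_one.
Qed.

Lemma letter_star n g : letter n g -> letter (- n) (star g).
Proof.
by case; rewrite ?opprK ?(starK (suq2_star HA)); constructor.
Qed.

Lemma word_span_star m n a : word_span m n a -> word_span m (- n) (star a).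
Proof.
elim=> {m n a}.
- by move=> m; rewrite oppr0 (star1 HA); apply: word_span_one.
- by move=> m n; rewrite (star0 HA); apply: word_span_zero.
- by move=> m n c x y _ hx _ hy; rewrite (star_linearP HA); apply: word_span_linear.
- move=> m n k g x /letter_star/letter_hom hg _ hx.
  rewrite (starM (suq2_star HA)) opprD addrC -addn1.
  exact: word_spanM.
Qed.

Definition homogeneous (n : int) (a : A) : Prop := exists m, word_span m n a.

Lemma homogeneous_subspace n : subspace (homogeneous n).
Proof.
split=> [|c x y [m hx] [m' hy]]; first by exists 0%N; apply: word_span_zero.
exists (maxn m m'); apply: word_span_linear.
  by apply: word_span_widen hx; apply: leq_maxl.
by apply: word_span_widen hy; apply: leq_maxr.
Qed.

Lemma homogeneousM n n' a b :
  homogeneous n a -> homogeneous n' b -> homogeneous (n + n') (a * b).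
Proof. by move=> [m ha] [m' hb]; exists (m + m')%N; apply: word_spanM. Qed.

Lemma homogeneous_star n a : homogeneous n a -> homogeneous (- n) (star a).
Proof. by move=> [m ha]; exists m; apply: word_span_star. Qed.

(** Only existence of the decomposition is claimed here; separation of the degrees is supplied by
    the Haar integral in [haar_homogeneous]. *)
Lemma homogeneous_total a : decomposable homogeneous a.
Proof.
have subd := decomposable_subspace homogeneous_subspace.
have d1 := decomposable1 homogeneous_subspace.
apply: (suq2_ind HA) => [|c x y|x y|].
- by apply: (d1 0); exists 0%N; apply: word_span_one.
- exact: subd.2.
- move=> [s [f [_ hf ->]]] [t [g [_ hg ->]]]; rewrite mulr_suml.
  apply: subspace_sum => // i _ _; rewrite mulr_sumr.
  apply: subspace_sum => // j _ _; apply: (d1 (i + j)).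
  exact: homogeneousM.
- split; [apply: (d1 1)|apply: (d1 1)|apply: (d1 (-1))|apply: (d1 (-1))];
    exists 1%N; apply: letter_hom; constructor.
Qed.

Lemma homogeneous_ind (P : A -> Prop) : subspace P ->
  (forall m n a, word_span m n a -> P a) -> forall a, P a.
Proof.
move=> sP Phom a; have [s [f [_ hf ->]]] := homogeneous_total a.
by apply: subspace_sum => // i _ _; have [m] := hf i; apply: Phom.
Qed.

Definition seq_span (V : lmodType R[i]) (s : seq V) (x : V) : Prop :=
  exists c : 'I_(size s) -> R[i], x = \sum_(i < size s) c i *: s`_i.

Lemma seq_span_subspace (V : lmodType R[i]) (s : seq V) : subspace (seq_span s).
Proof.
split=> [|k x y [a ->] [b ->]].
  by exists (fun=> 0); rewrite big1 // => i _; rewrite scale0r.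
exists (fun i => k * a i + b i); rewrite scaler_sumr -big_split /=.
by apply: eq_bigr => i _; rewrite scalerDl scalerA.
Qed.

Lemma seq_span_mem (V : lmodType R[i]) (s : seq V) x : x \in s -> seq_span s x.
Proof.
move=> xs; have ixs := xs; rewrite -index_mem in ixs.
exists (fun i => (i == Ordinal ixs)%:R); rewrite (bigD1 (Ordinal ixs)) //= eqxx.
by rewrite scale1r nth_index // big1 ?addr0 // => i /negPf ->; rewrite scale0r.
Qed.

Lemma seq_span_sub (V : lmodType R[i]) (s : seq V) (P : V -> Prop) x : subspace P ->
  (forall y, y \in s -> P y) -> seq_span s x -> P x.
Proof.
move=> sP Ps [c ->]; apply: subspace_sum => // i _ _; apply: subspaceZ => //.
by apply: Ps; apply: mem_nth.
Qed.

(** Multiplying a spanning list for length m by the four generators, and adding 1, gives one for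
    length m + 1. This is the source of the finite-dimensional spaces stable under nabla. *)
Lemma word_span_finite m : exists s : seq A, forall n a, word_span m n a -> seq_span s a.
Proof.
elim: m => [|m [s hs]].
  exists [:: 1] => n a; move e : 0%N => m ha; elim: ha e => {m n a} //.
  - by move=> m _; apply: seq_span_mem; rewrite mem_seq1.
  - by move=> m n _; apply: subspace0; apply: seq_span_subspace.
  - move=> m n c x y _ hx _ hy em; apply: (seq_span_subspace _).2.
      exact: hx.
    exact: hy.
pose gens := [:: al; ga; star al; star ga].
exists (1 :: [seq g * x | g <- gens, x <- s]) => n a; move e : m.+1 => m' ha.
elim: ha e => {m' n a}.
- by move=> m' _; apply: seq_span_mem; rewrite mem_head.
- by move=> m' n _; apply: subspace0; apply: seq_span_subspace.
- move=> m' n c x y _ hx _ hy em; apply: (seq_span_subspace _).2.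
    exact: hx.
  exact: hy.
move=> m' n k g x lg hx _ [em]; rewrite -em in hx.
have subx := seq_span_subspace (1 :: [seq g * x | g <- gens, x <- s]).
apply: (@seq_span_sub _ s (fun x => seq_span _ (g * x))) (hs _ _ hx).
  split=> [|c y z hy hz]; first by rewrite mulr0; apply: subspace0.
  by rewrite mulrDr -scalerAr; apply: subx.2.
move=> y ys; apply: seq_span_mem; rewrite inE; apply/orP; right.
by apply: allpairs_f => //; case: lg; rewrite !inE eqxx ?orbT.
Qed.

End Homogeneous.

(** * Left-invariant vector fields *)

Section VectorFields.
Variables (R : realType) (q : R).
Hypotheses (q_neq0 : 0 < `|q|) (q_lt1 : `|q| < 1).
Variables (A : algType R[i]) (star : A -> A) (al ga : A).
Variables (Om : algType R[i]) (iota : {lrmorphism A -> Om}) (e1 e2 e3 : Om).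
Variables (starO : Om -> Om) (d : {linear Om -> Om}).
Local Notation qc := (q%:C : R[i]).
Hypothesis HA : suq2_algebra qc star al ga.
Hypothesis HOm : woronowicz_algebra qc star al ga iota e1 e2 e3.
Hypothesis HstarO : woronowicz_involution qc star iota e1 e2 e3 starO.
Hypothesis Hd : woronowicz_differential qc star al ga iota e1 e2 e3 starO d.
Local Notation word_span := (word_span star al ga).
Local Notation letter := (letter star al ga).
Local Notation one_form := (one_form e1 e2 e3).
Local Notation inv_form := (inv_form e1 e2 e3).
Local Notation form_coef := (form_coef HOm).

Definition eta_eps (k : nat) : int := nth 0 [:: 1; 2; 1] k.
Definition twist (k : nat) (n : int) : R := q ^ (- eta_eps k * n).

Lemma twist0 k : twist k 0 = 1. Proof. by rewrite /twist mulr0 expr0z. Qed.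

Lemma twistD k n m : twist k (n + m) = twist k n * twist k m.
Proof. by rewrite /twist mulrDr exprzDr ?q_unit. Qed.

Lemma eta_letter k n g : letter n g ->
  one_form k * iota g = (twist k n)%:C *: (iota g * one_form k).
Proof.
have [a1 a2 a3 a4] := eta1_comm HOm; have [b1 b2 b3 b4] := eta2_comm HOm.
have [c1 c2 c3 c4] := eta3_comm HOm.
by case: k => [|[|[|k]]]; [| | |by rewrite /one_form /= nth_nil mul0r mulr0 scaler0];
  case; rewrite /twist real_expz.
Qed.

Lemma eta_hom k m n a : word_span m n a ->
  one_form k * iota a = (twist k n)%:C *: (iota a * one_form k).
Proof.
elim=> {m n a}.
- by move=> m; rewrite twist0 scale1r rmorph1 mul1r mulr1.
- by move=> m n; rewrite raddf0 mulr0 mul0r scaler0.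
- move=> m n c x y _ hx _ hy; rewrite linearP mulrDr mulrDl -scalerAr hx hy.
  by rewrite -scalerAl scalerDr !scalerA mulrC.
- move=> m n j g x /eta_letter hg _ hx.
  rewrite rmorphM mulrA hg -scalerAl -[_ * one_form k * _]mulrA hx -scalerAr scalerA mulrA.
  by rewrite twistD rmorphM.
Qed.

(** The endomorphism by which the k-th 1-form moves past coefficients ([eta_iota]); [vector_field k]
    is the matching component of [d] ([d_iotaE]). Position 0 of the basis holds the form 1, whence
    the index [k.+1]. *)
Definition eta_twist (k : nat) (a : A) : A := form_coef (one_form k * iota a) (inord k.+1).
Definition vector_field (k : nat) (a : A) : A := form_coef (d (iota a)) (inord k.+1).
Local Notation K := eta_twist.
Local Notation X := vector_field.

Lemma eta_twist_linear k : linear (K k).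
Proof.
move=> c x y; rewrite /K linearP mulrDr -scalerAr.
exact: form_coef_linear.
Qed.

Lemma vector_field_linear k : linear (X k).
Proof. by move=> c x y; rewrite /X !linearP; exact: form_coef_linear. Qed.

HB.instance Definition _ k := GRing.isLinear.Build _ _ _ _ (K k) (eta_twist_linear k).
HB.instance Definition _ k := GRing.isLinear.Build _ _ _ _ (X k) (vector_field_linear k).

Lemma form_coef_eta (k j : 'I_3) a :
  form_coef (iota a * one_form j) (inord k.+1) = if k == j then a else 0.
Proof.
have lt8 (i : 'I_3) : (i.+1 < 8)%N by apply: (@leq_trans 4); rewrite // ltnS.
rewrite (_ : one_form j = inv_form (inord j.+1 : 'I_8)).
  rewrite form_coef_form; congr (if _ then _ else _).
  by rewrite -!val_eqE /= !inordK.
by rewrite inordK // eta_form ltn_ord.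
Qed.

Lemma form_coef_eta_sum (x : nat -> A) (k : 'I_3) :
  form_coef (\sum_(j < 3) iota (x j) * one_form j) (inord k.+1) = x k.
Proof.
rewrite (big_morph (fun w => form_coef w (inord k.+1)) (id1 := 0) (op1 := +%R)).
- rewrite (bigD1 k) //= form_coef_eta eqxx big1 ?addr0 // => j jk.
  by rewrite form_coef_eta eq_sym (negPf jk).
- by move=> u v; have := form_coef_linear HOm (inord k.+1) 1 u v; rewrite !scale1r.
- by have := form_coef_iota HOm 0 0 (inord k.+1); rewrite mulr0 mul0r.
Qed.

Lemma eta_twist_hom (k : 'I_3) m n a : word_span m n a -> K k a = (twist k n)%:C *: a.
Proof.
move=> ha; rewrite /K (eta_hom _ ha) scalerAl -linearZ form_coef_eta eqxx //.
Qed.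

Lemma iotaZM c a w : iota (c *: a) * w = c *: (iota a * w).
Proof. by rewrite linearZ_LR scalerAl. Qed.

(** Induction on words by the Leibniz rule, where moving a 1-form past the tail of a word costs a
    [twist]. For [e2] the eigenvalues then follow [levelD], starting from the values 1 and -q^2 on
    letters of degree 1 and -1. *)
Lemma d_hom m n a : word_span m n a -> exists x : nat -> A,
  [/\ forall k, (k < 3)%N -> word_span m (n - eta_weight k) (x k),
      x 1%N = (level q n)%:C *: a & d (iota a) = \sum_(k < 3) iota (x k) * one_form k].
Proof.
have q0 := qc_neq0 q_neq0; have q0' : q != 0 by rewrite -normr_gt0.
have q21 := one_sub_q2_neq0 q_lt1.
have l1 : level q 1 = 1.
  by rewrite /level (_ : q ^ (-2 * 1) = q ^- 2) //; field; rewrite q0' q21.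
have lN1 : level q (-1) = - q ^+ 2.
  by rewrite /level (_ : q ^ (-2 * -1) = q ^+ 2) //; field.
have dgen n' g : letter n' g -> exists x : nat -> A,
  [/\ forall k, (k < 3)%N -> word_span 1 (n' - eta_weight k) (x k),
      x 1%N = (level q n')%:C *: g & d (iota g) = \sum_(k < 3) iota (x k) * one_form k].
  have L n0 g0 c : letter n0 g0 -> word_span 1 n0 (c *: g0).
    by move=> lg; apply: subspaceZ; [exact: word_span_subspace|exact: letter_hom].
  have Lal := L _ _ _ (letter_al star al ga); have Lga := L _ _ _ (letter_ga star al ga).
  have Lals := L _ _ _ (letter_als star al ga); have Lgas := L _ _ _ (letter_gas star al ga).
  case.
  - exists (fun k => [:: 0; 1 *: al; - qc ^+ 2 *: star ga]`_k); split.
    + by case=> [|[|[|k]]] //= _; first [exact: word_span_zero|exact: Lal|exact: Lgas].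
    + by rewrite l1 rmorph1.
    + rewrite (d_al Hd) !big_ord_recl big_ord0 /= raddf0 mul0r add0r addr0 scale1r.
      by rewrite iotaZM scaleNr.
  - exists (fun k => [:: 0; 1 *: ga; qc *: star al]`_k); split.
    + by case=> [|[|[|k]]] //= _; first [exact: word_span_zero|exact: Lga|exact: Lals].
    + by rewrite l1 rmorph1.
    + rewrite (d_ga Hd) !big_ord_recl big_ord0 /= raddf0 mul0r add0r addr0 scale1r.
      by rewrite iotaZM.
  - exists (fun k => [:: -1 *: ga; - qc ^+ 2 *: star al; 0]`_k); split.
    + by case=> [|[|[|k]]] //= _; first [exact: Lga|exact: Lals|exact: word_span_zero].
    + by rewrite lN1 rmorphN rmorphXn.
    + rewrite (d_al_star Hd) !big_ord_recl big_ord0 /= raddf0 mul0r !addr0.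
      by rewrite !iotaZM scaleN1r addrC.
  - exists (fun k => [:: qc^-1 *: al; - qc ^+ 2 *: star ga; 0]`_k); split.
    + by case=> [|[|[|k]]] //= _; first [exact: Lal|exact: Lgas|exact: word_span_zero].
    + by rewrite lN1 rmorphN rmorphXn.
    + rewrite (d_ga_star Hd) !big_ord_recl big_ord0 /= raddf0 mul0r !addr0.
      by rewrite !iotaZM addrC.
elim=> {m n a}.
- move=> m; exists (fun=> 0); split=> [k _||].
  + exact: word_span_zero.
  + by rewrite /level mulr0 expr0z subrr mulr0 mul0r raddf0 scale0r.
  + by rewrite rmorph1 (d_one Hd) big1 // => k _; rewrite raddf0 mul0r.
- move=> m n; exists (fun=> 0); split=> [k _||].
  + exact: word_span_zero.
  + by rewrite scaler0.
  + by rewrite raddf0 linear0 big1 // => k _; rewrite mul0r.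
- move=> m n c x y _ [u [hu u1 du]] _ [v [hv v1 dv]].
  exists (fun k => c *: u k + v k); split=> [k k3||].
  + by apply: word_span_linear; [apply: hu|apply: hv].
  + by rewrite u1 v1 scalerDr !scalerA mulrC.
  + rewrite !linearP du dv scaler_sumr -big_split /=; apply: eq_bigr => k _.
    by rewrite linearP mulrDl scalerAl.
- move=> m n j g x lg hx [v [hv v1 dv]]; have [u [hu u1 du]] := dgen _ _ lg.
  exists (fun k => (twist k j)%:C *: (u k * x) + g * v k); split=> [k k3||].
  + apply: word_span_linear.
      rewrite (_ : n + j - _ = n - eta_weight k + j); last by rewrite addrAC.
      by apply: (@word_spanM _ _ _ _ _ 1); [apply: hu|].
    by rewrite -addrA; apply: word_span_letterM => //; apply: hv.
  + rewrite u1 v1 -scalerAl -scalerAr scalerA -scalerDl -rmorphM -rmorphD.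
    by rewrite (levelD q_neq0 q_lt1).
  + rewrite rmorphM (d_iota Hd) du dv mulr_suml mulr_sumr -big_split /=.
    apply: eq_bigr => k _; rewrite -mulrA (eta_hom _ hx) -scalerAr mulrA mulrA.
    by rewrite raddfD mulrDl /= iotaZM !rmorphM.
Qed.

Lemma d_iotaE a : d (iota a) = \sum_(k < 3) iota (X k a) * one_form k.
Proof.
move: a; apply: (homogeneous_ind HA); first split=> [|c x y hx hy].
- by rewrite raddf0 linear0 big1 // => k _; rewrite linear0 raddf0 mul0r.
- rewrite !linearP hx hy scaler_sumr -big_split /=; apply: eq_bigr => k _.
  by rewrite !linearP mulrDl scalerAl.
- move=> m n a ha; have [x [_ _ dx]] := d_hom ha; rewrite {1}dx.
  by apply: eq_bigr => k _; rewrite /X dx form_coef_eta_sum.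
Qed.

Lemma vector_field_hom (k : 'I_3) m n a : word_span m n a ->
  word_span m (n - eta_weight k) (X k a).
Proof.
by move=> ha; have [x [hx _ dx]] := d_hom ha; rewrite /X dx form_coef_eta_sum; apply: hx.
Qed.

Lemma vector_field1_hom m n a : word_span m n a -> X 1 a = (level q n)%:C *: a.
Proof.
move=> ha; have [x [_ x1 dx]] := d_hom ha; rewrite -x1 /X dx.
exact: (form_coef_eta_sum x (Ordinal (isT : (1 < 3)%N))).
Qed.

Lemma eta_iota (k : 'I_3) a : one_form k * iota a = iota (K k a) * one_form k.
Proof.
move: a; apply: (homogeneous_ind HA); first split=> [|c x y hx hy].
- by rewrite !raddf0 mul0r mulr0.
- by rewrite !linearP mulrDr mulrDl -scalerAr hx hy -scalerAl.
- by move=> m n a ha; rewrite (eta_hom _ ha) (eta_twist_hom _ ha) iotaZM.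
Qed.

Lemma iota_eta_inj (k : 'I_3) a b : iota a * one_form k = iota b * one_form k -> a = b.
Proof.
by move/(congr1 (fun w => form_coef w (inord k.+1))); rewrite !form_coef_eta eqxx.
Qed.

Lemma eta_twistM (k : 'I_3) a b : K k (a * b) = K k a * K k b.
Proof.
apply: (@iota_eta_inj k); rewrite -eta_iota !rmorphM mulrA eta_iota.
by rewrite -[_ * _ * iota b]mulrA eta_iota mulrA.
Qed.

Lemma vector_fieldM (k : 'I_3) a b : X k (a * b) = X k a * K k b + a * X k b.
Proof.
pose x (j : nat) := X j a * K j b + a * X j b.
rewrite -[RHS](form_coef_eta_sum x k) {1}/X; congr (form_coef _ _).
rewrite rmorphM (d_iota Hd) 2!d_iotaE mulr_suml mulr_sumr -big_split /=.
apply: eq_bigr => j _; rewrite -[_ * _ * iota b]mulrA eta_iota raddfD /=.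
by rewrite !rmorphM mulrDl !mulrA.
Qed.

Lemma vector_field_eq (x : nat -> A) (k : 'I_3) a :
  d (iota a) = \sum_(j < 3) iota (x j) * one_form j -> X k a = x k.
Proof. by move=> e; rewrite /X e form_coef_eta_sum. Qed.

Let i0 : 'I_3 := Ordinal (isT : (0 < 3)%N).
Let i1 : 'I_3 := Ordinal (isT : (1 < 3)%N).
Let i2 : 'I_3 := Ordinal (isT : (2 < 3)%N).

(** Compare coefficients in d (star a) = star (d a). The involution exchanges [e1] and [e3] up to
    scalars, and moving them back to the right of the coefficients produces [K]. *)
Lemma vector_field_star (k : 'I_3) a : X k (star a) =
  [:: qc^-1 *: K 0 (star (X 2 a)); - K 1 (star (X 1 a));
      qc *: K 2 (star (X 0 a))]`_k.
Proof.
have sl := starO_conj_linear HstarO.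
have sD : {morph starO : x y / x + y}.
  by move=> x y; have := sl 1 x y; rewrite rmorph1 !scale1r.
have s0 : starO 0 = 0.
  by have := sD 0 0; rewrite addr0 => /eqP; rewrite -subr_eq subrr => /eqP.
apply: (@vector_field_eq (fun k : nat => [:: qc^-1 *: K 0 (star (X 2 a));
  - K 1 (star (X 1 a)); qc *: K 2 (star (X 0 a))]`_k)).
rewrite -(starO_iota HstarO) (d_star Hd) d_iotaE (big_morph starO sD s0).
have sE (j : 'I_3) :
    starO (iota (X j a) * one_form j) = starO (one_form j) * iota (star (X j a)).
  rewrite (starOM HstarO (iota_degree _ _ _ _ _) (eta_degree _ _ _ _ _)).
  by rewrite scale1r (starO_iota HstarO).
under eq_bigr => j _ do rewrite sE.
rewrite !big_ord_recl !big_ord0 /= !addr0.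
rewrite [starO (one_form 0)](starO_eta1 HstarO) [starO (one_form 1)](starO_eta2 HstarO).
rewrite [starO (one_form 2)](starO_eta3 HstarO) mulNr -!scalerAl.
rewrite (eta_iota i2) (eta_iota i1) (eta_iota i0) /= !iotaZM raddfN /= mulNr.
by rewrite [LHS]addrC [X in X + _ = _]addrC -addrA.
Qed.

Lemma vector_field_one (k : 'I_3) : X k 1 = 0.
Proof.
apply: (@vector_field_eq (fun=> 0)).
by rewrite rmorph1 (d_one Hd) big1 // => j _; rewrite raddf0 mul0r.
Qed.

Lemma eta_twist_one (k : 'I_3) : K k 1 = 1.
Proof. by apply: (@iota_eta_inj k); rewrite -eta_iota rmorph1 mulr1 mul1r. Qed.

Lemma vector_field0_gen :
  [/\ X 0 al = 0, X 0 ga = 0, X 0 (star al) = - ga & X 0 (star ga) = qc^-1 *: al].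
Proof.
split.
- apply: (@vector_field_eq (fun k => [:: 0; al; - qc ^+ 2 *: star ga]`_k) i0).
  rewrite (d_al Hd) !big_ord_recl big_ord0 /= raddf0 mul0r add0r addr0.
  by rewrite iotaZM scaleNr.
- apply: (@vector_field_eq (fun k => [:: 0; ga; qc *: star al]`_k) i0).
  by rewrite (d_ga Hd) !big_ord_recl big_ord0 /= raddf0 mul0r add0r addr0 iotaZM.
- apply: (@vector_field_eq (fun k => [:: - ga; - qc ^+ 2 *: star al; 0]`_k) i0).
  rewrite (d_al_star Hd) !big_ord_recl big_ord0 /= raddf0 mul0r !addr0 iotaZM.
  by rewrite raddfN /= mulNr addrC.
- apply: (@vector_field_eq (fun k => [:: qc^-1 *: al; - qc ^+ 2 *: star ga; 0]`_k) i0).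
  rewrite (d_ga_star Hd) !big_ord_recl big_ord0 /= raddf0 mul0r !addr0 !iotaZM.
  by rewrite addrC.
Qed.

End VectorFields.

(** * The Haar integral *)

Section Tensor.
Variables (R : realType) (A T : algType R[i]) (star : A -> A) (starT : T -> T).
Variable tens : {bilinear A -> A -> T}.
Hypothesis HT : tensor_square star starT tens.

Lemma tens_lift (W : lmodType R[i]) (f : A -> A -> W) :
  bilinear_for *:%R *:%R f ->
  exists g : {linear T -> W}, forall a b, g (tens a b) = f a b.
Proof.
move=> bf.
pose F : {bilinear A -> A -> W} :=
  HB.pack f (bilinear_isBilinear.Build R[i] A A W *:%R *:%R f bf).
by have [g hg _] := tens_universal HT F; exists g.
Qed.

Lemma tens_ext (W : lmodType R[i]) (f1 f2 : T -> W) : linear f1 -> linear f2 ->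
  (forall a b, f1 (tens a b) = f2 (tens a b)) -> f1 =1 f2.
Proof.
move=> l1 l2 e.
pose g1 : {linear T -> W} := HB.pack f1 (GRing.isLinear.Build R[i] T W *:%R f1 l1).
pose g2 : {linear T -> W} := HB.pack f2 (GRing.isLinear.Build R[i] T W *:%R f2 l2).
have bf : bilinear_for *:%R *:%R (fun a b => g2 (tens a b)).
  split=> [b c x y|a c x y]; first by rewrite -linearP -linearPl.
  by rewrite -linearP -linearPr.
pose F : {bilinear A -> A -> W} :=
  HB.pack (fun a b => g2 (tens a b)) (bilinear_isBilinear.Build R[i] A A W *:%R *:%R _ bf).
have [g _ gu] := tens_universal HT F.
move=> x; exact: etrans (gu g1 e x) (esym (gu g2 (fun _ _ => erefl) x)).
Qed.

Lemma tens_slice (F : {linear A -> A}) :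
  exists g : {linear T -> T}, forall a b, g (tens a b) = tens a (F b).
Proof.
apply: tens_lift; split=> [b c x y|a c x y] /=; first by rewrite linearPl.
by rewrite linearP linearPr.
Qed.

Variables (al ga : A) (q : R[i]).
Hypothesis HA : suq2_algebra q star al ga.
Variable Delta : {lrmorphism A -> T}.
Variable h : {scalar A}.
Hypothesis Hh : haar_integral tens Delta h.

(* A left-invariant twisted derivation [X] commutes with the coaction:        *)
(* [Delta X = (id (x) X) Delta]; applying [h (x) id] gives [h (X a) = 0].     *)
Lemma haar_derivation (X K : {linear A -> A}) (idX idK : {linear T -> T}) :
  (forall a b, idX (tens a b) = tens a (X b)) ->
  (forall a b, idK (tens a b) = tens a (K b)) ->
  (forall a b, X (a * b) = X a * K b + a * X b) ->
  (forall a b, K (a * b) = K a * K b) -> X 1 = 0 -> K 1 = 1 ->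
  (forall g, g \in [:: al; ga; star al; star ga] ->
     Delta (X g) = idX (Delta g) /\ Delta (K g) = idK (Delta g)) ->
  forall a, h (X a) = 0.
Proof.
move=> idXE idKE XM KM X1 K1 gens.
have idKM u v : idK (u * v) = idK u * idK v.
  move: u; apply: tens_ext => [c x y|c x y|a b].
  - by rewrite mulrDl -scalerAl linearP.
  - by rewrite linearP mulrDl -scalerAl.
  move: v; apply: tens_ext => [c x y|c x y|a' b'].
  - by rewrite mulrDr -scalerAr linearP.
  - by rewrite linearP mulrDr -scalerAr.
  by rewrite (tensM HT) !idKE (tensM HT) KM.
have idXM u v : idX (u * v) = idX u * idK v + u * idX v.
  move: u; apply: tens_ext => [c x y|c x y|a b].
  - by rewrite mulrDl -scalerAl linearP.
  - by rewrite linearP !mulrDl -!scalerAl scalerDr addrACA.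
  move: v; apply: tens_ext => [c x y|c x y|a' b'].
  - by rewrite mulrDr -scalerAr linearP.
  - by rewrite !linearP !mulrDr -!scalerAr scalerDr addrACA.
  by rewrite (tensM HT) !idXE idKE !(tensM HT) XM linearDr.
(* The twisted Leibniz rule on T reduces equivariance to generators; [K] has to be carried along
   because it occurs in that rule. *)
have equiv : forall a, Delta (X a) = idX (Delta a) /\ Delta (K a) = idK (Delta a).
  apply: (suq2_ind HA).
  - by rewrite X1 K1 raddf0 rmorph1 -(tens1 HT) idXE idKE X1 K1 linear0r.
  - by move=> c x y [hx hx'] [hy hy']; rewrite !linearP /= hx hy hx' hy'.
  - move=> x y [hx hx'] [hy hy']; rewrite XM KM raddfD /= !rmorphM /= idXM idKM.
    by rewrite hx hy hx' hy'.
  - by split; apply: gens; rewrite !inE eqxx ?orbT.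
have [S SE] : exists S : {linear T -> A}, forall a b, S (tens a b) = h a *: b.
  apply: tens_lift; split=> [b c x y|a c x y] /=.
    by rewrite linearP scalerDl scalerA.
  by rewrite scalerDr !scalerA mulrC.
move=> a; have e := haar_right Hh SE (X a); rewrite (equiv a).1 in e.
(* Slicing the first factor commutes with acting on the second, so h (X a) 1 = X (h a 1) = 0. *)
have SX x : S (idX x) = X (S x).
  move: x; apply: tens_ext => [c x y|c x y|x y]; rewrite ?linearP //.
  by rewrite idXE !SE linearZ.
rewrite SX (haar_right Hh SE) linearZ_LR X1 scaler0 in e.
by have := congr1 h e; rewrite linearZ_LR raddf0 /= (haar1 Hh) mulr1 => <-.
Qed.

End Tensor.

(** * Integration by parts for the vector fields *)

Section HaarVectorFields.
Variables (R : realType) (q : R).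
Hypotheses (q_neq0 : 0 < `|q|) (q_lt1 : `|q| < 1).
Variables (A : algType R[i]) (star : A -> A) (al ga : A).
Variables (T : algType R[i]) (starT : T -> T) (tens : {bilinear A -> A -> T}).
Variables (Delta : {lrmorphism A -> T}) (h : {scalar A}).
Variables (Om : algType R[i]) (iota : {lrmorphism A -> Om}) (e1 e2 e3 : Om).
Variables (starO : Om -> Om) (d : {linear Om -> Om}) (ip : {dot Om for Num.conj}).
Local Notation qc := (q%:C : R[i]).
Hypothesis HA : suq2_algebra qc star al ga.
Hypothesis HT : tensor_square star starT tens.
Hypothesis HDelta : suq2_comultiplication qc star al ga starT tens Delta.
Hypothesis Hh : haar_integral tens Delta h.
Hypothesis HOm : woronowicz_algebra qc star al ga iota e1 e2 e3.
Hypothesis HstarO : woronowicz_involution qc star iota e1 e2 e3 starO.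
Hypothesis Hd : woronowicz_differential qc star al ga iota e1 e2 e3 starO d.
Hypothesis Hip : woronowicz_inner_product qc star iota e1 e2 e3 h ip.
Local Notation word_span := (word_span star al ga).
Local Notation letter := (letter star al ga).
Local Notation X := (vector_field d HOm).
Local Notation K := (eta_twist HOm).

Let i0 : 'I_3 := Ordinal (isT : (0 < 3)%N).
Let i1 : 'I_3 := Ordinal (isT : (1 < 3)%N).
Let i2 : 'I_3 := Ordinal (isT : (2 < 3)%N).

Lemma comul_als : Delta (star al) = tens (star al) (star al) - qc *: tens ga (star ga).
Proof.
have sl := star_conj_linear (tens_star_involution HT).
rewrite (comul_star HDelta) (comul_al HDelta) addrC -scaleNr sl !(tens_star HT).
by rewrite !(starK (suq2_star HA)) rmorphN /= conj_realC scaleNr addrC.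
Qed.

Lemma comul_gas : Delta (star ga) = tens (star ga) (star al) + tens al (star ga).
Proof.
have sl := star_conj_linear (tens_star_involution HT).
rewrite (comul_star HDelta) (comul_ga HDelta) -[tens ga al]scale1r sl !(tens_star HT).
by rewrite !(starK (suq2_star HA)) rmorph1 scale1r.
Qed.

(** In the coproduct of a letter all second tensor factors are letters of the same degree, so F acts
    on them by one common scalar. *)
Lemma scalar_equivariant (F : {linear A -> A}) (idF : {linear T -> T}) (c : int -> R[i]) :
  (forall a b, idF (tens a b) = tens a (F b)) ->
  (forall n g, letter n g -> F g = c n *: g) ->
  forall n g, letter n g -> Delta (F g) = idF (Delta g).
Proof.
have idFB x y : idF (x - qc *: y) = idF x - qc *: idF y by rewrite linearB linearZ.
have idFD x y : idF (x + y) = idF x + idF y by rewrite linearD.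
move=> idFE Fg n g lg; rewrite (Fg _ _ lg) linearZ_LR /=.
have Fal := Fg _ _ (letter_al star al ga); have Fga := Fg _ _ (letter_ga star al ga).
have Fals := Fg _ _ (letter_als star al ga); have Fgas := Fg _ _ (letter_gas star al ga).
case: lg.
- rewrite (comul_al HDelta) scalerBr idFB !idFE Fal Fga !linearZr_LR.
  by rewrite !scalerA mulrC.
- by rewrite (comul_ga HDelta) scalerDr idFD !idFE Fal Fga !linearZr_LR.
- rewrite comul_als scalerBr idFB !idFE Fals Fgas !linearZr_LR.
  by rewrite !scalerA mulrC.
- by rewrite comul_gas scalerDr idFD !idFE Fals Fgas !linearZr_LR.
Qed.

Lemma letter_gens g : g \in [:: al; ga; star al; star ga] -> exists n, letter n g.
Proof.
rewrite !inE => /or4P[] /eqP ->; [exists 1|exists 1|exists (-1)|exists (-1)]; constructor.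
Qed.

Lemma eta_twist_letter (k : 'I_3) n g : letter n g -> K k g = (twist q k n)%:C *: g.
Proof. by move/letter_hom; apply: eta_twist_hom. Qed.

Lemma haar_vector_field0 a : h (X 0 a) = 0.
Proof.
have [idX idXE] := tens_slice HT (X i0); have [idK idKE] := tens_slice HT (K i0).
apply: (haar_derivation HT HA Hh idXE idKE) => //.
- exact: (vector_fieldM q_neq0 q_lt1 HA HOm Hd i0).
- exact: (eta_twistM q_neq0 HA HOm i0).
- exact: (vector_field_one HOm Hd i0).
- exact: (eta_twist_one q_neq0 HA HOm i0).
move=> g /letter_gens[n lg]; split; last first.
  exact: (scalar_equivariant idKE (eta_twist_letter i0)) lg.
have [Xal Xga Xals Xgas] := vector_field0_gen HOm Hd.
have {}idXE a' b : idX (tens a' b) = tens a' (X 0 b) := idXE a' b.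
case: lg => /=.
- rewrite (comul_al HDelta) raddfB /= linearZ_LR !idXE Xal Xga !linear0r scaler0.
  by rewrite subrr raddf0.
- by rewrite (comul_ga HDelta) raddfD /= !idXE Xal Xga !linear0r addr0 raddf0.
- rewrite comul_als raddfB /= linearZ_LR !idXE Xals Xgas linearNr linearZr_LR raddfN /=.
  rewrite (comul_ga HDelta) scalerA mulfV ?qc_neq0 // scale1r -opprD.
  by rewrite addrC.
- rewrite comul_gas raddfD /= !idXE Xals Xgas linearNr linearZr_LR linearZ_LR /=.
  rewrite (comul_al HDelta) scalerBr scalerA mulVf ?qc_neq0 // scale1r.
  by rewrite addrC.
Qed.

Lemma haar_vector_field1 a : h (X 1 a) = 0.
Proof.
have [idX idXE] := tens_slice HT (X i1); have [idK idKE] := tens_slice HT (K i1).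
apply: (haar_derivation HT HA Hh idXE idKE) => //.
- exact: (vector_fieldM q_neq0 q_lt1 HA HOm Hd i1).
- exact: (eta_twistM q_neq0 HA HOm i1).
- exact: (vector_field_one HOm Hd i1).
- exact: (eta_twist_one q_neq0 HA HOm i1).
move=> g /letter_gens[n lg]; split; last first.
  exact: (scalar_equivariant idKE (eta_twist_letter i1)) lg.
have Xg n' g' : letter n' g' -> X i1 g' = (level q n')%:C *: g'.
  by move/letter_hom; apply: (vector_field1_hom q_neq0 q_lt1 HOm Hd).
exact: (scalar_equivariant idXE (c := fun n => (level q n)%:C) Xg lg).
Qed.

Lemma expz_eq1 (n : int) : q ^ n = 1 -> n = 0.
Proof.
have aux (k : nat) : q ^+ k.+1 = 1 -> False.
  move=> e; have : `|q| ^+ k.+1 < 1 by rewrite exprn_ilt1 ?normr_ge0.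
  by rewrite -normrX e normr1 ltxx.
case: n => [[//|k]|k]; rewrite /exprz; first by move/aux.
by move/(congr1 GRing.inv); rewrite invrK invr1 => /aux.
Qed.

Lemma level_eq0 n : level q n = 0 -> n = 0.
Proof.
move/eqP; rewrite /level mulf_eq0 invr_eq0 (negPf (one_sub_q2_neq0 q_lt1)) orbF.
rewrite mulf_eq0 expf_eq0 /= -normr_eq0 gt_eqF //= subr_eq0 => /eqP/expz_eq1/eqP.
by rewrite mulf_eq0 /= => /eqP.
Qed.

(** The second vector field multiplies a by [level q n], which is nonzero, while h kills its
    image. *)
Lemma haar_homogeneous n a : homogeneous star al ga n a -> n != 0 -> h a = 0.
Proof.
move=> [m ha] n0; have := haar_vector_field1 a.
rewrite (vector_field1_hom q_neq0 q_lt1 HOm Hd ha) linearZ_LR /= => /eqP.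
rewrite mulf_eq0 fmorph_eq0 => /orP[/eqP/level_eq0 n00|/eqP//].
by rewrite n00 eqxx in n0.
Qed.

(** The twist is trivial in degree 0, and h vanishes in all other degrees. *)
Lemma haar_twist (k : 'I_3) a : h (K k a) = h a.
Proof.
move: a; apply: (homogeneous_ind HA); first split=> [|c x y hx hy].
- by rewrite !raddf0.
- by rewrite !linearP /= hx hy.
- move=> m n a ha; rewrite (eta_twist_hom q_neq0 HOm k ha) linearZ_LR /=.
  have [->|n0] := eqVneq n 0; first by rewrite twist0 rmorph1 mul1r.
  by rewrite (haar_homogeneous (a := a) (ex_intro _ m ha) n0) mulr0.
Qed.

Lemma ip_form (a b : A) (i j : 'I_8) :
  ip (iota a * inv_form e1 e2 e3 i) (iota b * inv_form e1 e2 e3 j) =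
  h (star b * a) * ip (inv_form e1 e2 e3 i) (inv_form e1 e2 e3 j).
Proof.
have li (i' : 'I_8) : left_invariant_form e1 e2 e3 (inv_form e1 e2 e3 i').
  exists (fun j => (j == i')%:R); rewrite (bigD1 i') //= eqxx scale1r big1 ?addr0 //.
  by move=> j' /negPf ->; rewrite scale0r.
exact: (ip_left_invariant Hip) (li i) (li j).
Qed.

Lemma ip_iota a b : ip (iota a) (iota b) = h (star b * a).
Proof.
have := ip_form a b 0 0; rewrite /inv_form /= !mulr1 => ->.
by have := ip_orthonormal Hip 0 0; rewrite /inv_orthonormal_basis /= => ->; rewrite mulr1.
Qed.

(** Forced by the Hermitian symmetry of [ip] on coefficients. *)
Lemma haar_star a : h (star a) = Num.conj (h a).
Proof.
have := ip_iota 1 a; rewrite mulr1 => <-; rewrite ip_conj ip_iota.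
by rewrite (star1 HA) mul1r.
Qed.

Definition vector_field_adj (k : nat) (a : A) : A :=
  [:: - qc^-1 *: X 2 a; X 1 a; - qc *: X 0 a]`_k.

(** Integrate [X k (star b * a)], whose integral is 0. By [vector_field_star] both terms for k = 0,
    1 carry a [K k]-twist that [haar_twist] removes from the first, up to moving [a] inside it. The
    case k = 2 follows from k = 0 by taking adjoints. *)
Lemma vector_field_adjP (k : 'I_3) a b :
  h (star b * X k a) = h (star (vector_field_adj k b) * a).
Proof.
have sM := starM (suq2_star HA); have sK := starK (suq2_star HA).
have q0 := qc_neq0 q_neq0.
have conjq : Num.conj qc = qc by apply: conj_realC.
have h20 u v : h (star (X 2 u) * v) = - qc * h (star u * X 0 v).
  have := haar_vector_field0 (star u * v).
  rewrite (vector_fieldM q_neq0 q_lt1 HA HOm Hd i0).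
  rewrite (vector_field_star q_neq0 q_lt1 HA HOm HstarO Hd i0) /= -scalerAl.
  rewrite -(eta_twistM q_neq0 HA HOm i0) raddfD /= linearZ_LR /=.
  rewrite (haar_twist i0) => /eqP; rewrite addr_eq0 => /eqP e.
  by rewrite mulNr -mulrN -e mulrA mulfV // mul1r.
case: k => [[|[|[|k]]] //= _]; rewrite /vector_field_adj /=.
- rewrite (starZ HA) rmorphN /= fmorphV /= conjq -scalerAl linearZ_LR /= h20.
  by rewrite mulrA mulrNN mulVf // mul1r.
- have := haar_vector_field1 (star b * a).
  rewrite (vector_fieldM q_neq0 q_lt1 HA HOm Hd i1).
  rewrite (vector_field_star q_neq0 q_lt1 HA HOm HstarO Hd i1) /= mulNr.
  rewrite -(eta_twistM q_neq0 HA HOm i1) raddfD raddfN /= (haar_twist i1) addrC.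
  by move/eqP; rewrite subr_eq0 => /eqP.
- rewrite (starZ HA) rmorphN /= conjq -scalerAl linearZ_LR /=.
  rewrite -[star b * X 2 a]sK haar_star sM sK h20 rmorphM /= rmorphN /= conjq.
  by rewrite -haar_star sM sK.
Qed.

Lemma vector_field_adj_word_span (k : 'I_3) m n a : word_span m n a ->
  word_span m (n + eta_weight k) (vector_field_adj k a).
Proof.
move=> ha; have hX k' := vector_field_hom q_neq0 q_lt1 HOm Hd k' ha.
have sub := word_span_subspace star al ga m.
case: k => [[|[|[|k]]] //= _]; rewrite /vector_field_adj /=.
- by apply: subspaceZ => //; exact: (hX i2).
- exact: (hX i1).
- by apply: subspaceZ => //; exact: (hX i0).
Qed.

End HaarVectorFields.

(** * Weights of forms *)

Section WeightedForms.
Variables (R : realType) (q : R).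
Hypotheses (q_neq0 : 0 < `|q|) (q_lt1 : `|q| < 1).
Variables (A : algType R[i]) (star : A -> A) (al ga : A).
Variables (T : algType R[i]) (starT : T -> T) (tens : {bilinear A -> A -> T}).
Variables (Delta : {lrmorphism A -> T}) (h : {scalar A}).
Variables (Om : algType R[i]) (iota : {lrmorphism A -> Om}) (e1 e2 e3 : Om).
Variables (starO : Om -> Om) (d : {linear Om -> Om}) (ip : {dot Om for Num.conj}).
Variable dstar : {linear Om -> Om}.
Local Notation qc := (q%:C : R[i]).
Hypothesis HA : suq2_algebra qc star al ga.
Hypothesis HT : tensor_square star starT tens.
Hypothesis HDelta : suq2_comultiplication qc star al ga starT tens Delta.
Hypothesis Hh : haar_integral tens Delta h.
Hypothesis HOm : woronowicz_algebra qc star al ga iota e1 e2 e3.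
Hypothesis HstarO : woronowicz_involution qc star iota e1 e2 e3 starO.
Hypothesis Hd : woronowicz_differential qc star al ga iota e1 e2 e3 starO d.
Hypothesis Hip : woronowicz_inner_product qc star iota e1 e2 e3 h ip.
Hypothesis Hdstar : adjoint_of ip d dstar.
Local Notation word_span := (word_span star al ga).
Local Notation X := (vector_field d HOm).
Local Notation E := (inv_form e1 e2 e3).
Local Notation eta := (one_form e1 e2 e3).
Local Notation form_coef := (form_coef HOm).
Local Notation nrm := (form_norm ip).
Local Notation re := complex.Re.

(* [weighted m N] is spanned by the [a * E i] with [a] a word of length at    *)
(* most [m] such that the degree of [a] and the weight of [E i] add up to [N].*)
Definition weighted (m : nat) (N : int) (w : Om) : Prop :=
  exists c : 'I_8 -> A, (forall i : 'I_8, word_span m (N - form_weight i) (c i)) /\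
    w = \sum_(i < 8) iota (c i) * E i.

Definition weight_space (N : int) (w : Om) : Prop := exists m, weighted m N w.

Lemma weighted_subspace m N : subspace (weighted m N).
Proof.
have sub := word_span_subspace star al ga m.
split=> [|c x y [u [hu ->]] [v [hv ->]]].
  exists (fun=> 0); split=> [i|]; first exact: subspace0.
  by rewrite big1 // => i _; rewrite raddf0 mul0r.
exists (fun i => c *: u i + v i); split=> [i|]; first exact: (sub _).2.
rewrite scaler_sumr -big_split /=; apply: eq_bigr => i _.
by rewrite linearP mulrDl scalerAl.
Qed.

Lemma weight_space_subspace N : subspace (weight_space N).
Proof.
split=> [|c x y [m [u [hu ->]]] [m' [v [hv ->]]]].
  by exists 0%N; apply: subspace0; apply: weighted_subspace.
exists (maxn m m'); apply: (weighted_subspace _ _).2.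
  by exists u; split=> // i; apply: word_span_widen (hu i); apply: leq_maxl.
by exists v; split=> // i; apply: word_span_widen (hv i); apply: leq_maxr.
Qed.

Lemma weighted_form m n N c a j : (j < 8)%N -> word_span m n a ->
  c = 0 \/ n + form_weight j = N -> weighted m N (iota a * (c *: E j)).
Proof.
move=> j8 ha [->|nj]; first by rewrite scale0r mulr0; apply: subspace0; apply: weighted_subspace.
rewrite -scalerAr; apply: subspaceZ; first exact: weighted_subspace.
exists (fun i : 'I_8 => if i == Ordinal j8 then a else 0); split=> [i|].
  case: eqP => [->|_] /=; last exact: word_span_zero.
  by rewrite -nj addrK.
exact: (iota_form_sum iota e1 e2 e3 (Ordinal j8) a).
Qed.

(** Vanishing products have coefficient 0 and a dummy index, so weights are compared only in the
    other alternative. *)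
Lemma mul_weight k i : (k < 3)%N -> (i < 8)%N -> (mul_index k i < 8)%N /\
  (mul_coef q k i = 0 \/ form_weight (mul_index k i) = eta_weight k + form_weight i).
Proof.
case: k => [|[|[|k]]] // _; case: i => [|[|[|[|[|[|[|[|i]]]]]]]] // _; split => //;
  by [left|right].
Qed.

Lemma d_weight i : (i < 8)%N -> (d_index i < 8)%N /\
  (d_coef q i = 0 \/ form_weight (d_index i) = form_weight i).
Proof.
case: i => [|[|[|[|[|[|[|[|i]]]]]]]] // _; split=> //; by [left|right].
Qed.

Lemma d_iota_form a i : d (iota a * E i) =
  \sum_(k < 3) iota (X k a) * (mul_coef q k i *: E (mul_index k i)) +
  iota a * (d_coef q i *: E (d_index i)).
Proof.
rewrite (d_iota Hd) (d_form q_neq0 HOm Hd) (d_iotaE q_neq0 q_lt1 HA HOm Hd).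
rewrite mulr_suml; congr (_ + _); apply: eq_bigr => k _.
by rewrite -mulrA (eta_mul q_neq0 HOm).
Qed.

Lemma weighted_d m N w : weighted m N w -> weighted m N (d w).
Proof.
have sub := weighted_subspace m N.
move=> [c [hc ->]]; rewrite linear_sum; apply: subspace_sum => // i _ _.
have ci := hc i; rewrite /= d_iota_form; apply: subspaceD => //.
  apply: subspace_sum => // k _ _; have [m8 hm] := mul_weight (ltn_ord k) (ltn_ord i).
  apply: weighted_form (vector_field_hom q_neq0 q_lt1 HOm Hd k ci) _ => //.
  by case: hm => [->|->]; [left|right]; rewrite // addrA subrK subrK.
have [m8 hm] := d_weight (ltn_ord i).
by apply: weighted_form ci _ => //; case: hm => [->|->]; [left|right]; rewrite // subrK.
Qed.

(** Uniqueness of coefficients would only force 1 = 0 in A; the normalization of [ip] at 1 excludes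
    this. *)
Lemma inv_form_neq0 (i : 'I_8) : E i != 0.
Proof.
apply/eqP => e; have := form_coef_form HOm i i 1.
rewrite eqxx e mulr0 -[X in form_coef X](mul0r (E i)) -(raddf0 iota) form_coef_form eqxx => a0.
have := ip_orthonormal Hip 0 0; rewrite /inv_orthonormal_basis /=.
have -> : (1 : Om) = 0 by rewrite -(rmorph1 iota) -a0 raddf0.
by rewrite linear0l => /esym/eqP; rewrite oner_eq0.
Qed.

Lemma inv_form_ortho (i j : 'I_8) : i != j -> ip (E i) (E j) = 0.
Proof.
have q0 := qc_neq0 q_neq0.
pose O := inv_orthonormal_basis qc e1 e2 e3.
have sc (k : 'I_8) : exists s, E k = s *: O k.
  case: k => [[|[|[|[|[|[|[|[|k]]]]]]]] //= Hk]; rewrite /O /inv_orthonormal_basis /inv_form /=.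
  - by exists 1; rewrite scale1r.
  - by exists 1; rewrite scale1r.
  - by exists 1; rewrite scale1r.
  - by exists 1; rewrite scale1r.
  - by exists (qc ^+ 7); rewrite scalerA mulfV ?scale1r // expf_neq0.
  - by exists qc^-1; rewrite scalerA mulVf ?scale1r.
  - by exists (- qc ^+ 6); rewrite scalerA mulrNN mulfV ?scale1r // expf_neq0.
  - by exists 1; rewrite scale1r.
move=> ij; have [s ->] := sc i; have [t ->] := sc j.
rewrite linearZl_LR linearZr_LR /= (ip_orthonormal Hip i j) (negPf ij).
by rewrite !mulr0.
Qed.

Let ip_iota_form := ip_form Hip.

Lemma ip_scaled_form a b c j (i : 'I_8) : (j < 8)%N ->
  ip (iota a * (c *: E j)) (iota b * E i) =
  c * (j == i)%:R * ip (E i) (E i) * h (star b * a).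
Proof.
move=> j8; rewrite -scalerAr linearZl_LR /=.
have -> : ip (iota a * E j) (iota b * E i) = h (star b * a) * ip (E j) (E i).
  exact: (ip_iota_form a b (Ordinal j8) i).
rewrite -!mulrA; congr (_ * _); have [->|ji] := eqVneq j i; first by rewrite mul1r mulrC.
by rewrite mul0r (inv_form_ortho (i := Ordinal j8)) ?mulr0.
Qed.

Lemma inv_form_span_ind (P : Om -> Prop) : subspace P ->
  (forall a (i : 'I_8), P (iota a * E i)) -> forall w, P w.
Proof. by move=> sP hP w; rewrite (form_coefE HOm w); apply: subspace_sum. Qed.

(** The adjoint is found explicitly by pairing with each [iota a * E i]. The formula involves only
    adjoint vector fields, which keep the bound m on the word length; orthogonality of weights alone
    would not show this. *)
Lemma weighted_dstar m N w : weighted m N w -> weighted m N (dstar w).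
Proof.
have sub := weighted_subspace m N; have subw := word_span_subspace star al ga m.
move=> [c [hc ->]]; rewrite linear_sum; apply: subspace_sum => // j _ _ /=.
have := hc j; move: (c j) => b hb {c hc}.
pose n i := ip (E i) (E i).
(* The basis forms are orthogonal but not normalized, hence the ratio of squared norms. *)
pose g k (i : 'I_8) := mul_coef q k i * (mul_index k i == j)%:R * n j / n i.
pose g' (i : 'I_8) := d_coef q i * (d_index i == j)%:R * n j / n i.
pose y i := \sum_(k < 3) Num.conj (g k i) *: vector_field_adj d HOm k b +
  Num.conj (g' i) *: b.
have hy (i : 'I_8) : word_span m (N - form_weight i) (y i).
  apply: subspaceD => //.
    apply: subspace_sum => // k _ _.
    have [_ hm] := mul_weight (ltn_ord k) (ltn_ord i).
    rewrite /g; case: hm => [->|hm]; first by rewrite !mul0r rmorph0 scale0r; apply: subspace0.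
    have [mj|_] := eqVneq (mul_index k i) j; last first.
      by rewrite mulr0 !mul0r rmorph0 scale0r; apply: subspace0.
    apply: subspaceZ => //.
    have := vector_field_adj_word_span q_neq0 q_lt1 HOm Hd k hb.
    rewrite (_ : N - form_weight j + _ = N - form_weight i) //.
    by rewrite -mj hm; ring.
  have [_ hm] := d_weight (ltn_ord i).
  rewrite /g'; case: hm => [->|hm]; first by rewrite !mul0r rmorph0 scale0r; apply: subspace0.
  have [mj|_] := eqVneq (d_index i) j; last first.
    by rewrite mulr0 !mul0r rmorph0 scale0r; apply: subspace0.
  by apply: subspaceZ => //; rewrite -hm mj.
suff -> : dstar (iota b * E j) = \sum_(i < 8) iota (y i) * E i by exists y.
set w' := \sum_(i < 8) _.
suff H v : ip v (dstar (iota b * E j)) = ip v w'.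
  by apply/eqP; rewrite -subr_eq0 -(dnorm_eq0 ip) linearBr /= H subrr.
move: v; apply: inv_form_span_ind => [|a i].
  split=> [|k u v hu hv]; first by rewrite !linear0l.
  by rewrite !linearDl !linearZl_LR /= hu hv.
rewrite -Hdstar d_iota_form linearDl linear_sumlz /=.
have [d8 _] := d_weight (ltn_ord i); rewrite ip_scaled_form //.
rewrite /w' linear_sumr /= (bigD1 i) //= [X in _ = _ + X]big1 ?addr0; last first.
  by move=> i' ii'; rewrite ip_iota_form inv_form_ortho ?mulr0 // eq_sym.
rewrite ip_iota_form.
have ni : n i != 0 by rewrite dnorm_eq0 inv_form_neq0.
have sD : {morph star : x y / x + y} by exact: (starD HA).
rewrite /y (starD HA) (big_morph star sD (star0 HA)) mulrDl mulr_suml raddfD raddf_sum /=.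
rewrite mulrDl mulr_suml; congr (_ + _).
  apply: eq_bigr => k _; have [m8 _] := mul_weight (ltn_ord k) (ltn_ord i).
  rewrite ip_scaled_form // (starZ HA) conjCK -[_ *: star _ * a]scalerAl
    [h (_ *: (_ * a))]linearZ_LR /=.
  rewrite (vector_field_adjP q_neq0 q_lt1 HA HT HDelta Hh HOm HstarO Hd Hip).
  by rewrite /g [RHS]mulrAC divfK.
rewrite (starZ HA) conjCK -[_ *: star _ * a]scalerAl [h (_ *: (_ * a))]linearZ_LR /=.
by rewrite /g' [RHS]mulrAC divfK.
Qed.


Let D (w : Om) : Om := d w + dstar w.
Let nabla (w : Om) : Om := D (D w).

Lemma weighted_locally_finite N w : weight_space N w ->
  exists (n : nat) (s : 'I_n -> Om), forall k, exists c : 'I_n -> R[i],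
    iter k nabla w = \sum_(i < n) c i *: s i.
Proof.
move=> [m hw]; have [s hs] := word_span_finite star al ga m.
pose t := [seq iota x * E (i : 'I_8) | x <- s, i <- enum 'I_8].
exists (size t), (fun i => t`_i) => k.
have : weighted m N (iter k nabla w).
  elim: k => //= k hk; have hD u : weighted m N u -> weighted m N (D u).
    move=> hu; apply: subspaceD; first exact: weighted_subspace.
      exact: weighted_d.
    exact: weighted_dstar.
  by apply/hD/hD.
move=> [c [hc ->]]; have subt := seq_span_subspace t.
apply: (subspace_sum (P := seq_span t)) => // i _ _.
apply: (@seq_span_sub _ _ s (fun x => seq_span t (iota x * E i))) (hs _ _ (hc i)).
  split=> [|a x y hx hy]; first by rewrite raddf0 mul0r; apply: subspace0.
  by rewrite linearP mulrDl -scalerAl; apply: subt.2.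
move=> x xs; apply: seq_span_mem; apply: (allpairs_f (fun x i => iota x * E (i : 'I_8))) => //.
by rewrite mem_enum.
Qed.

Lemma weight_space_coef N w (i : 'I_8) : weight_space N w ->
  homogeneous star al ga (N - form_weight i) (form_coef w i).
Proof. by move=> [m [c [hc wE]]]; exists m; rewrite (form_coef_unique HOm wE). Qed.

(** In the pairing of two coefficients of the same basis form, h is applied to an element of degree
    N - M. *)
Lemma weight_space_ortho N M u v : N != M ->
  weight_space N u -> weight_space M v -> ip u v = 0.
Proof.
move=> NM Wu Wv; rewrite (form_coefE HOm u) (form_coefE HOm v) linear_sumlz big1 // => i _.
rewrite linear_sumr big1 // => j _ /=; rewrite ip_iota_form.
have [<-|ij] := eqVneq i j; last by rewrite inv_form_ortho ?mulr0.
have hu := weight_space_coef i Wu; have hv := weight_space_coef i Wv.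
have huv := homogeneousM (homogeneous_star HA hv) hu.
rewrite (haar_homogeneous q_neq0 q_lt1 HA HT HDelta Hh HOm Hd huv) ?mul0r //.
rewrite (_ : _ + _ = N - M) ?subr_eq0 //; ring.
Qed.

Lemma weight_space_total w : decomposable weight_space w.
Proof.
have subd := decomposable_subspace weight_space_subspace.
move: w; apply: inv_form_span_ind => // a i.
move: a; apply: (homogeneous_ind HA); first split=> [|c x y hx hy].
- by rewrite raddf0 mul0r; apply: subspace0.
- by rewrite linearP mulrDl -scalerAl; apply: subd.2.
- move=> m n a ha; apply: (@decomposable1 _ _ _ _ weight_space_subspace (n + form_weight i)).
  by exists m; rewrite -[E i]scale1r; apply: weighted_form ha _ => //; right.
Qed.

Lemma weight_space_d N w : weight_space N w -> weight_space N (d w).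
Proof. by move=> [m hw]; exists m; apply: weighted_d. Qed.

(** On a E with a of degree n and E of weight p, [contr_eta_form] keeps only the [e2] part of d a,
    contributing q^(-2p) level n. The part with d E contributes level p by [d_contr_form], and
    [levelD] adds them to level (n + p). *)
Lemma contraction_Cartan N w : weight_space N w ->
  d (contraction HOm w) + contraction HOm (d w) = (level q N)%:C *: w.
Proof.
have cl := contraction_linear HOm.
have c0 : contraction HOm 0 = 0 by have := contractionZ HOm 0 0; rewrite !scale0r.
move=> [m [c [hc ->]]].
pose P w := d (contraction HOm w) + contraction HOm (d w) = (level q N)%:C *: w.
have sP : subspace P.
  split=> [|k x y hx hy]; rewrite /P.
    by rewrite c0 linear0 c0 scaler0 addr0.
  by rewrite cl !(linearP d) /= cl addrACA -scalerDr hx hy [RHS]scalerDr !scalerA mulrC.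
apply: (subspace_sum sP) => i _ _; have := hc i; move: (c i) => a ha {c hc}; rewrite /P.
have cD x y : contraction HOm (x + y) = contraction HOm x + contraction HOm y.
  by have := cl 1 x y; rewrite !scale1r.
rewrite contraction_iota !(d_iota Hd) cD [contraction HOm (iota a * _)]contraction_iota.
rewrite addrACA -mulrDr.
rewrite (d_contr_form q_neq0 q_lt1 HOm Hd) //.
rewrite (d_iotaE q_neq0 q_lt1 HA HOm Hd) !mulr_suml (big_morph _ cD c0) -big_split /=.
have tE (k : 'I_3) : iota (X k a) * eta k * contraction HOm (E i) +
    contraction HOm (iota (X k a) * eta k * E i) =
    if k == 1 :> nat then iota (X k a) * ((q ^ (-2 * form_weight i))%:C *: E i) else 0.
  rewrite -!mulrA contraction_iota -mulrDr (contr_eta_form q_neq0 HOm) //.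
  by case: ifP; rewrite ?mulr0.
under eq_bigr => k _ do rewrite tE.
rewrite !big_ord_recl big_ord0 /= add0r !addr0.
rewrite (vector_field1_hom q_neq0 q_lt1 HOm Hd ha) iotaZM -!scalerAr scalerA -scalerDl.
by rewrite -rmorphM -rmorphD mulrC -(levelD q_neq0 q_lt1) subrK.
Qed.

(** * Norm estimates for contraction, coefficients and 1-forms *)

Lemma norm_iota_form a (i : 'I_8) : nrm (iota a * E i) = nrm (iota a) * nrm (E i).
Proof.
apply/eqP; rewrite -(eqrXn2 (n := 2)) ?mulr_ge0 ?form_norm_ge0 //.
apply/eqP/complexI; rewrite exprMn [in RHS]rmorphM /= -!ip_self ip_iota_form.
by rewrite (ip_iota Hip).
Qed.

Lemma norm_scaled_form a c j : (j < 8)%N ->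
  nrm (iota a * (c *: E j)) = Normc.normc c * nrm (E j) * nrm (iota a).
Proof.
move=> j8; rewrite -scalerAr form_normZ (norm_iota_form a (Ordinal j8)) /=.
by rewrite mulrA mulrAC.
Qed.

Lemma norm_coef w (i : 'I_8) : nrm (iota (form_coef w i)) * nrm (E i) <= nrm w.
Proof.
rewrite -norm_iota_form -ler_sqr ?nnegrE ?form_norm_ge0 //.
rewrite {2}(form_coefE HOm w) form_Pythagoras ?index_enum_uniq //.
  by rewrite (bigD1 i) //= lerDl sumr_ge0 // => j _; rewrite sqr_ge0.
by move=> j k jk; rewrite ip_iota_form inv_form_ortho ?mulr0.
Qed.

Lemma norm_inv_form_gt0 (i : 'I_8) : 0 < nrm (E i).
Proof.
rewrite lt_def form_norm_ge0 andbT; apply: contraNneq (inv_form_neq0 i) => e.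
by apply/eqP; exact: form_norm_eq0 e.
Qed.

Lemma norm_coef_le w (i : 'I_8) : nrm (iota (form_coef w i)) <= nrm w / nrm (E i).
Proof. by rewrite ler_pdivlMr ?norm_inv_form_gt0 ?norm_coef. Qed.

Lemma normc_ge0 (c : R[i]) : 0 <= Normc.normc c.
Proof. by case: c => a b; rewrite sqrtr_ge0. Qed.

Lemma contr_index_lt8 i : (i < 8)%N -> (contr_index i < 8)%N.
Proof. by case: i => [|[|[|[|[|[|[|[|i]]]]]]]]. Qed.

Lemma contraction_bounded :
  exists2 C, 0 <= C & forall w, nrm (contraction HOm w) <= C * nrm w.
Proof.
pose f (i : nat) := Normc.normc (contr_coef q i) * nrm (E (contr_index i)).
have f0 i : 0 <= f i by rewrite mulr_ge0 ?normc_ge0 ?form_norm_ge0.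
exists (\sum_(i < 8) f i / nrm (E i)) => [|w].
  by apply: sumr_ge0 => i _; rewrite divr_ge0 ?form_norm_ge0.
apply: (le_trans (ler_form_norm_sum _ _ _ _)); rewrite mulr_suml.
apply: ler_sum => i _; rewrite norm_scaled_form ?contr_index_lt8 //.
by rewrite -[X in _ <= X]mulrA -/(f i) ler_wpM2l ?f0 // [leRHS]mulrC norm_coef_le.
Qed.

Lemma ip_iota_adjoint a u v : ip (iota a * u) v = ip u (iota (star a) * v).
Proof.
have sM := starM (suq2_star HA); have sK := starK (suq2_star HA).
move: u; apply: inv_form_span_ind => [|b i].
  split=> [|k x y hx hy]; first by rewrite mulr0 !linear0l.
  by rewrite mulrDr -scalerAr !linearDl !linearZl_LR /= hx hy.
move: v; apply: inv_form_span_ind => [|c j].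
  split=> [|k x y hx hy]; first by rewrite mulr0 !linear0r.
  by rewrite mulrDr -scalerAr !linearDr !linearZr_LR /= hx hy.
by rewrite !mulrA -!rmorphM !ip_iota_form sM sK mulrA.
Qed.

(** The first three defining relations make all four generators contractions, and boundedness passes
    to sums and products. *)
Lemma iota_bounded a : exists2 C, 0 <= C & forall w, nrm (iota a * w) <= C * nrm w.
Proof.
have [r1 r2 r3 r4 r5] := suq2_rel HA; have sK := starK (suq2_star HA).
have sq u w : nrm (iota u * w) ^+ 2 = re (ip (iota (star u * u) * w) w).
  by rewrite rmorphM -mulrA [in RHS]ip_iota_adjoint sK re_ip_self.
have contractive u : (forall w, nrm (iota u * w) ^+ 2 <= nrm w ^+ 2) ->
    exists2 C, 0 <= C & forall w, nrm (iota u * w) <= C * nrm w.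
  by move=> hu; exists 1 => // w; rewrite mul1r -ler_sqr ?nnegrE ?form_norm_ge0.
have sum1 w : nrm (iota al * w) ^+ 2 + nrm (iota ga * w) ^+ 2 = nrm w ^+ 2.
  rewrite !sq -re_ip_self -raddfD -linearDl -mulrDl -rmorphD r1 rmorph1 mul1r.
  by [].
move: a; apply: (suq2_ind HA).
- by exists 1 => // w; rewrite rmorph1 !mul1r.
- move=> c x y [Cx Cx0 hx] [Cy Cy0 hy].
  exists (Normc.normc c * Cx + Cy) => [|w]; first by rewrite addr_ge0 ?mulr_ge0 ?normc_ge0.
  rewrite linearP mulrDl -scalerAl; apply: (le_trans (ler_form_normD _ _ _)).
  by rewrite mulrDl form_normZ -mulrA; apply: lerD => //; apply: ler_wpM2l; rewrite ?normc_ge0.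
- move=> x y [Cx Cx0 hx] [Cy Cy0 hy]; exists (Cx * Cy) => [|w]; first by rewrite mulr_ge0.
  rewrite rmorphM -!mulrA; apply: (le_trans (hx _)).
  exact: ler_wpM2l.
- split; apply: contractive => w; have := sum1 w.
  + by move=> <-; rewrite lerDl sqr_ge0.
  + by move=> <-; rewrite lerDr sqr_ge0.
  + move=> _; have e : nrm (iota (star al) * w) ^+ 2 + q ^+ 2 * nrm (iota (star ga) * w) ^+ 2
        = nrm w ^+ 2.
      rewrite !sq !sK -re_realM -[_ * ip _ w]linearZl_LR -raddfD -linearDl /= scalerAl.
      rewrite -linearZ -mulrDl -rmorphD rmorphXn r2 rmorph1 mul1r.
      by rewrite re_ip_self.
    by rewrite -e lerDl mulr_ge0 ?sqr_ge0.
  + by move=> <-; rewrite !sq sK r3 lerDr -sq sqr_ge0.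
Qed.


Definition level_growth (m : int) : R := 1 + q ^ (-2 * m) + `|level q m|.

Lemma expz_even_ge0 (m : int) : 0 <= q ^ (-2 * m).
Proof.
rewrite (_ : -2 * m = - m + - m); last by ring.
by rewrite exprzDr ?q_unit // -expr2 sqr_ge0.
Qed.

Lemma level_growth_gt0 m : 0 < level_growth m.
Proof. by rewrite /level_growth -addrA ltr_pwDl // addr_ge0 ?expz_even_ge0. Qed.

Lemma level_growthP N m :
  1 + `|level q (N + m)| <= level_growth m * (1 + `|level q N|).
Proof.
have h0 := expz_even_ge0 m; have h1 := normr_ge0 (level q m).
have h2 := normr_ge0 (level q N).
have : `|level q (N + m)| <= q ^ (-2 * m) * `|level q N| + `|level q m|.
  rewrite (levelD q_neq0 q_lt1); apply: (le_trans (ler_normD _ _)).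
  by rewrite normrM (ger0_norm h0).
rewrite /level_growth; move: (q ^ _) `|level q m| `|level q N| h0 h1 h2 => x y z.
nra.
Qed.

(** q^(-2n) is an affine function of [level q n] with slope r, and |q^(-n)| is its square root. *)
Lemma twist_bounded : exists2 C, 0 <= C &
  forall (k : 'I_3) n, `|twist q k n| <= C * (1 + `|level q n|).
Proof.
have q2 : 0 < q ^+ 2 by rewrite -real_normK ?num_real // exprn_gt0.
have q21 : 0 < 1 - q ^+ 2.
  by rewrite subr_gt0 -real_normK ?num_real // exprn_ilt1.
pose r := (1 - q ^+ 2) / q ^+ 2; have r0 : 0 < r by rewrite divr_gt0.
exists (2 + r) => [|k n]; first by rewrite addr_ge0 // ltW.
have sq2 : q ^ (-2 * n) = 1 + r * level q n.
  have q0 : q != 0 by rewrite -normr_gt0.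
  by rewrite /r /level; field; rewrite ?q0 ?gt_eqF.
have sq1 : `|q ^ (-1 * n)| ^+ 2 = q ^ (-2 * n).
  rewrite real_normK ?num_real // expr2 -exprzDr ?q_unit //; congr (_ ^ _); ring.
(* The spare -1 absorbs the 1 in 2 y <= 1 + y^2, used for y = |q^(-n)| below. *)
have b2 : q ^ (-2 * n) <= (2 + r) * (1 + `|level q n|) - 1.
  rewrite sq2; have := ler_norm (level q n); have := normr_ge0 (level q n).
  by move: (level q n) `|level q n| => x y; nra.
have b1 : `|q ^ (-1 * n)| <= (2 + r) * (1 + `|level q n|).
  by have := sqr_ge0 (`|q ^ (-1 * n)| - 1); rewrite -sq1 in b2; nra.
case: k => [[|[|[|k]]] //= _].
by apply: le_trans (_ : q ^ (-2 * n) <= _); [rewrite ger0_norm ?expz_even_ge0|lra].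
Qed.

(** Moving the 1-form past a coefficient of degree N - [form_weight i] costs a [twist];
    [level_growth] absorbs the shift by the weight of the basis form. *)
Lemma one_form_bounded (k : 'I_3) : exists2 C, 0 <= C &
  forall N w, weight_space N w -> nrm (eta k * w) <= C * (1 + `|level q N|) * nrm w.
Proof.
have [Ct Ct0 hCt] := twist_bounded.
pose f (i : nat) := Normc.normc (mul_coef q k i) * nrm (E (mul_index k i)).
have f0 i : 0 <= f i by rewrite mulr_ge0 ?normc_ge0 ?form_norm_ge0.
pose g (i : 'I_8) := Ct * level_growth (- form_weight i) * (f i / nrm (E i)).
exists (\sum_(i < 8) g i) => [|N w Ww].
  apply: sumr_ge0 => i _; apply: mulr_ge0; last by rewrite divr_ge0 ?form_norm_ge0.
  by rewrite mulr_ge0 // ltW // level_growth_gt0.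
have eE : eta k * w = \sum_(i < 8) (twist q k (N - form_weight i))%:C *:
    (iota (form_coef w i) * (mul_coef q k i *: E (mul_index k i))).
  rewrite {1}(form_coefE HOm w) mulr_sumr; apply: eq_bigr => i _.
  have [m hm] := weight_space_coef i Ww.
  by rewrite mulrA (eta_hom q_neq0 HOm k hm) -scalerAl -mulrA (eta_mul q_neq0 HOm).
rewrite eE; apply: (le_trans (ler_form_norm_sum _ _ _ _)); rewrite !mulr_suml.
apply: ler_sum => i _; have [m8 _] := mul_weight (ltn_ord k) (ltn_ord i).
rewrite form_normZr norm_scaled_form // -/(f i).
have ht := hCt k (N - form_weight i); have hl := level_growthP N (- form_weight i).
have hc := norm_coef_le w i.
have -> : g i * (1 + `|level q N|) * nrm w =
    Ct * (level_growth (- form_weight i) * (1 + `|level q N|)) * (f i * (nrm w / nrm (E i))).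
  by rewrite /g; ring.
apply: ler_pM => //.
- exact: mulr_ge0 (f0 i) (form_norm_ge0 _ _).
- by apply: (le_trans ht); apply: ler_wpM2l.
- exact: ler_wpM2l (f0 i) _ _ hc.
Qed.

(** By the Leibniz rule the commutator is left multiplication by d a, the sum of the [X k a] times
    the 1-forms. *)
Lemma d_commutator_bounded a : exists2 C, 0 <= C & forall N w, weight_space N w ->
  nrm (d (iota a * w) - iota a * d w) <= C * (1 + `|level q N|) * nrm w.
Proof.
have hk (k : 'I_3) : exists2 C, 0 <= C & forall N w, weight_space N w ->
    nrm (iota (X k a) * eta k * w) <= C * (1 + `|level q N|) * nrm w.
  have [C1 C10 h1] := iota_bounded (X k a); have [C2 C20 h2] := one_form_bounded k.
  exists (C1 * C2) => [|N w Ww]; first exact: mulr_ge0.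
  rewrite -mulrA; apply: (le_trans (h1 _)); rewrite -!mulrA; apply: ler_wpM2l => //.
  by rewrite mulrA; apply: h2.
have [C0 p0 h0] := hk ord0; have [C1 p1 h1] := hk (lift ord0 ord0).
have [C2 p2 h2] := hk (lift ord0 (lift ord0 ord0)).
exists (C0 + (C1 + C2)) => [|N w Ww]; first by rewrite !addr_ge0.
rewrite (d_iota Hd) addrK (d_iotaE q_neq0 q_lt1 HA HOm Hd) !big_ord_recl big_ord0 addr0.
rewrite !mulrDl; apply: (le_trans (ler_form_normD _ _ _)); apply: lerD; first exact: h0.
by apply: (le_trans (ler_form_normD _ _ _)); apply: lerD; [exact: h1|exact: h2].
Qed.

(** * Boundedness of the commutators *)

Definition left_mul (b : A) (w : Om) : Om := iota b * w.

Lemma left_mul_linear b : linear (left_mul b).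
Proof. by move=> c u v; rewrite /left_mul mulrDr scalerAr. Qed.

HB.instance Definition _ b := GRing.isLinear.Build _ _ _ _ (left_mul b) (left_mul_linear b).

Variables (beta delta : R) (Rbeta Rdelta : {linear Om -> Om}).
Hypotheses (beta_ge0 : 0 <= beta) (delta_ge0 : 0 <= delta).
Hypothesis beta_delta : beta + delta = 1.
Hypothesis Rbeta_power : resolvent_power nabla beta Rbeta.
Hypothesis Rdelta_power : resolvent_power nabla delta Rdelta.

Let S a w := Rbeta (iota a * D (Rdelta w) - D (iota a * Rdelta w)).

Lemma homogeneous_commutator_bounded m n a : word_span m n a -> bounded_operator ip (S a).
Proof.
move=> ha; have hn : homogeneous star al ga n a by exists m.
have [C C0 hC] := contraction_bounded.
have [C1 C10 h1] := d_commutator_bounded a.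
have [C1' C10' h1'] := d_commutator_bounded (star a).
pose L b : {linear Om -> Om} := left_mul b.
have WL N w : weight_space N w -> weight_space (N + n) (L a w).
  move=> [m' [c [hc ->]]]; exists (m + m')%N.
  exists (fun i => a * c i); split=> [i|].
    by rewrite addrAC addrC; apply: word_spanM.
  by rewrite /L /= /left_mul mulr_sumr; apply: eq_bigr => i _; rewrite rmorphM mulrA.
have l0 N : 0 <= 1 + `|level q N| by rewrite addr_ge0.
(* The sums are common constants: [C1 + C1'] serves a and its adjoint, and the sum of the two growth
   factors serves shifts by n and by -n. *)
apply: (@weighted_commutator_bounded R Om ip d dstar weight_space (level q) Hdstar
  (d_square Hd) weight_space_subspace weight_space_ortho weight_space_total
  weight_space_d weighted_locally_finite (contraction HOm) C C0 hC contraction_Cartan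
  (L a) (L (star a)) n (C1 + C1') _ WL _ _ _
  (level_growth n + level_growth (- n)) _ _ _ beta delta) => //.
- by move=> u v; apply: ip_iota_adjoint.
- exact: addr_ge0.
- move=> N w Ww; apply: (le_trans (h1 N w Ww)).
  by rewrite !mulrDl lerDl !mulr_ge0 ?form_norm_ge0.
- move=> N w Ww; apply: (le_trans (h1' N w Ww)).
  by rewrite !mulrDl lerDr !mulr_ge0 ?form_norm_ge0.
- by rewrite addr_gt0 ?level_growth_gt0.
- move=> N; apply: (le_trans (level_growthP N n)).
  by rewrite [X in _ <= X]mulrDl lerDl mulr_ge0 // ltW ?level_growth_gt0.
- move=> N; have := level_growthP (N + n) (- n); rewrite addrK => /le_trans; apply.
  by rewrite [X in _ <= X]mulrDl lerDr mulr_ge0 // ltW ?level_growth_gt0.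
Qed.

(** The operator is linear in a, and a is a finite sum of homogeneous elements. *)
Lemma commutator_bounded a : bounded_operator ip (S a).
Proof.
move: a; apply: (homogeneous_ind HA); last exact: homogeneous_commutator_bounded.
split=> [|c x y [Mx hx] [My hy]].
  have D0 : D 0 = 0 by rewrite /D !linear0 addr0.
  exists 0 => w; rewrite /S (raddf0 iota) !mul0r D0 subrr linear0.
  by rewrite form_norm0.
exists (Normc.normc c * Mx + My) => w.
have -> : S (c *: x + y) w = c *: S x w + S y w.
  rewrite /S -linearP; congr (Rbeta _).
  have DP u v : D (c *: u + v) = c *: D u + D v.
    by rewrite /D !linearP /= scalerDr addrACA.
  have LP v : iota (c *: x + y) * v = c *: (iota x * v) + iota y * v.
    by rewrite linearP mulrDl scalerAl.
  by rewrite !LP DP scalerBr opprD addrACA.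
apply: (le_trans (ler_form_normD _ _ _)); rewrite form_normZ mulrDl -mulrA.
by apply: lerD => //; apply: ler_wpM2l; rewrite ?normc_ge0.
Qed.

End WeightedForms.

Theorem theorem8p5 (R : realType) (q : R)
    (q_neq0 : 0 < `|q|) (q_lt1 : `|q| < 1)
    (* the Hopf *-algebra A_q of SU_q(2) and its Haar integral *)
    (A : algType R[i]) (star : A -> A) (al ga : A)
    (HA : suq2_algebra q%:C star al ga)
    (T : algType R[i]) (starT : T -> T) (tens : {bilinear A -> A -> T})
    (HT : tensor_square star starT tens)
    (Delta : {lrmorphism A -> T})
    (HDelta : suq2_comultiplication q%:C star al ga starT tens Delta)
    (h : {scalar A}) (Hh : haar_integral tens Delta h)
    (* the three-dimensional *-differential calculus *)
    (Om : algType R[i]) (iota : {lrmorphism A -> Om}) (e1 e2 e3 : Om)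
    (HOm : woronowicz_algebra q%:C star al ga iota e1 e2 e3)
    (starO : Om -> Om)
    (HstarO : woronowicz_involution q%:C star iota e1 e2 e3 starO)
    (d : {linear Om -> Om})
    (Hd : woronowicz_differential q%:C star al ga iota e1 e2 e3 starO d)
    (ip : {dot Om for Num.conj})
    (Hip : woronowicz_inner_product q%:C star iota e1 e2 e3 h ip)
    (dstar : {linear Om -> Om}) (Hdstar : adjoint_of ip d dstar)
    (* R^beta and R^delta *)
    (beta delta : R) (beta_ge0 : 0 <= beta) (delta_ge0 : 0 <= delta)
    (beta_delta : beta + delta = 1)
    (Rbeta Rdelta : {linear Om -> Om}) :
  let D := fun w : Om => d w + dstar w in
  let nabla := fun w : Om => D (D w) in
  let L := fun (a : A) (w : Om) => iota a * w in
  resolvent_power nabla beta Rbeta ->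
  resolvent_power nabla delta Rdelta ->
  forall a : A,
    bounded_operator ip
      (fun w => Rbeta (L a (D (Rdelta w)) - D (L a (Rdelta w)))).
Proof.
move=> D nabla L Hbeta Hdelta a.
exact: (commutator_bounded q_neq0 q_lt1 HA HT HDelta Hh HOm HstarO Hd Hip Hdstar
  beta_ge0 delta_ge0 beta_delta Hbeta Hdelta a).
Qed.
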